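(* Let $P=\langle X\mid R\rangle$ be a presentation of a group $G$, satisfying conditions $\tau'$ and $C'(\frac12)$. Let $r_{\min}$ be the length of the shortest relator. Then any nontrivial word $W$ in the free group generated by $X$ representing the trivial element in $G$ has length at least $r_{\min}$. In particular, if $P$ has a relator of length greater than or equal to $2$, then $G$ is nontrivial.
   Context: **Presentations and diagrams.** For a presentation $P=\langle X\mid R\rangle$ the relators are assumed cyclically reduced, and no relator is a cyclic permutation of another relator or of the inverse of another relator. $R^*$ is the set of all cyclic permutations of elements of $R$ and of their inverses. A piece is a word which is a common prefix of two different elements of $R^*$. $K_P$ is the standard $2$-complex of $P$. A diagram over $P$ is a combinatorial map $\varphi\colon M\to K_P$ (open cells map homeomorphically onto open cells), where $M$ is obtained from a combinatorial cell structure on the $2$-sphere by removing some (possibly none) open $2$-cells; it is a spherical, disk or annular diagram if respectively $0$, $1$, $2$ open $2$-cells are removed. $\partial M$ is the boundary of $M$ in the sphere. Cells of dimension $0,1,2$ are called vertices, edges, faces. Via $\varphi$, edges of $M$ are labeled by elements of $X$ and their inverses, and the boundary label of an oriented face, read from any vertex, is an element of $R^*$. A diagram is reducible if it contains two faces $f,f'$ such that $\partial f\cap\partial f'$ contains an edge $e$ for which the boundary labels of $f$ and $f'$, read with opposite orientations and starting at an endpoint of $e$ (traversing $e$ first), coincide; otherwise it is reduced. The degree $d(v)$ of a vertex $v$ is the number of edges incident to $v$ (loops counted twice). A vertex is interior if it is not in $\partial M$. **Convention.** In a reduced diagram, interior vertices of degree $2$ are removed (merging the two incident edges), so that interior edges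 are labeled by pieces; the length $\ell(e)$ of such an edge is the length of its label, i.e. the number of original edges glued to form it. **Condition $\tau'$.** A corner $c$ of a face $f$ at an interior vertex $v$ lies between two consecutive edges at $v$, of lengths $\ell_1(c),\ell_2(c)$; $\ell_r(c)$ is the length of the relator corresponding to $f$. Put $d'_F(v)=\sum_{c\ni v}\frac{\ell_1(c)+\ell_2(c)}{\ell_r(c)}$, the sum over all corners at $v$. $P$ satisfies $\tau'$ if $d'_F(v)\le d(v)-2$ for every interior vertex $v$ of every reduced diagram over $P$ (with no interior vertices of degree $2$). **Condition $C'(\frac12)$.** Every piece $s$ which is a prefix of some $\rho\in R^*$ satisfies $\ell(s)<\frac12\ell(\rho)$, where $\ell$ denotes word length. *)

(* Defs.v *)
From mathcomp Require Import all_boot all_order all_algebra.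

Set Implicit Arguments.
Unset Strict Implicit.
Unset Printing Implicit Defensive.

Import GRing.Theory Num.Theory.
Local Open Scope ring_scope.

(* (x, false) stands for x and (x, true) for x^-1; words need not be freely
   reduced. *)
Definition letter (X : Type) : Type := (X * bool)%type.
Definition word (X : Type) : Type := seq (letter X).

Definition inv_letter X (a : letter X) : letter X := (a.1, ~~ a.2).
Definition inv_word X (w : word X) : word X := rev (map (@inv_letter X) w).

Definition freely_reduced X (w : word X) : Prop :=
  forall u v a, w <> u ++ [:: a; inv_letter a] ++ v.

Definition cyclic_perm X (w w' : word X) : Prop := exists k, w' = rot k w.

Definition cyclically_reduced X (w : word X) : Prop :=
  forall w', cyclic_perm w w' -> freely_reduced w'.

Record presentation (X : Type) := Presentation {
  relator :> word X -> Prop;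
  relator_reduced : forall r, relator r -> cyclically_reduced r;
  relator_distinct : forall r r', relator r -> relator r' -> r <> r' ->
    ~ cyclic_perm r r' /\ ~ cyclic_perm (inv_word r) r'
}.

(* Equality in F(X)/<<R>>; for R empty, equality in the free group F(X). *)
Inductive word_eq X (R : word X -> Prop) : word X -> word X -> Prop :=
| word_eq_refl w : word_eq R w w
| word_eq_sym w w' : word_eq R w w' -> word_eq R w' w
| word_eq_trans w w' w'' : word_eq R w w' -> word_eq R w' w'' -> word_eq R w w''
| word_eq_cancel u v a : word_eq R (u ++ [:: a; inv_letter a] ++ v) (u ++ v)
| word_eq_relator u v r : R r -> word_eq R (u ++ r ++ v) (u ++ v).

Definition free_eq X : word X -> word X -> Prop := word_eq (fun _ => False).

Definition eval_letter X (G : groupType) (g : X -> G) (a : letter X) : G :=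
  if a.2 then ((g a.1)^-1)%g else g a.1.
Definition eval X (G : groupType) (g : X -> G) (w : word X) : G :=
  foldr (fun a x => (eval_letter g a * x)%g) 1%g w.

(* g : X -> G induces an isomorphism from F(X)/<<R>> onto G. *)
Definition presents X (P : presentation X) (G : groupType) (g : X -> G) : Prop :=
  (forall x : G, exists w, eval g w = x) /\
  (forall w w', eval g w = eval g w' <-> word_eq P w w').

Definition Rstar X (R : word X -> Prop) (rho : word X) : Prop :=
  exists2 r, R r & cyclic_perm r rho \/ cyclic_perm (inv_word r) rho.

Definition prefix_of X (s w : word X) : Prop := exists t, w = s ++ t.

Definition piece X (R : word X -> Prop) (s : word X) : Prop :=
  exists rho1 rho2, [/\ Rstar R rho1, Rstar R rho2, rho1 <> rho2,
                        prefix_of s rho1 & prefix_of s rho2].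

Definition small_cancellation X (R : word X -> Prop) (lambda : rat) : Prop :=
  forall s rho, piece R s -> Rstar R rho -> prefix_of s rho ->
    (size s)%:R < lambda * (size rho)%:R.

Definition shortest_relator_length X (R : word X -> Prop) (n : nat) : Prop :=
  (exists2 r, R r & size r = n) /\ (forall r, R r -> (n <= size r)%N).

(* A cell structure on the sphere with at least one edge, as a connected
   combinatorial map of genus 0.  A dart is an oriented edge; it is attached to
   its initial vertex and to the face on a fixed side of it.  The edges, the
   vertices and the faces are the orbits of opp, of turn and of turn \o opp:
   turn d is the dart following d in the cyclic order around the initial vertex
   of d, and turn (opp d) follows d on the boundary of the face of d.  The last
   axiom is V + F = E + 2. *)
Record sphere_map := SphereMap {
  dart :> finType;
  opp : dart -> dart;
  turn : dart -> dart;
  oppK : involutive opp;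
  opp_neq : forall d, opp d != d;
  turn_inj : injective turn;
  sphere_connected : forall d d',
    connect [rel x y | (y == opp x) || (y == turn x)] d d';
  sphere_euler :
    (fcard turn dart + fcard (turn \o opp) dart = fcard opp dart + 2)%N
}.

Definition face_next (M : sphere_map) (d : M) : M := turn (opp d).

(* removed d: the open face of d is not in the diagram.  A removed face carries
   no constraint on its boundary label. *)
Record diagram X (R : word X -> Prop) := Diagram {
  cells :> sphere_map;
  removed : pred cells;
  removed_face : forall d, removed (face_next d) = removed d;
  lab : cells -> letter X;
  lab_opp : forall d, lab (opp d) = inv_letter (lab d);
  lab_face : forall d, ~~ removed d ->
    Rstar R [seq lab x | x <- orbit (@face_next cells) d]
}.

Section Diagram.

Variables (X : Type) (R : word X -> Prop) (M : diagram R).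
Implicit Types d : M.

(* The boundary label of the face of d, read from the initial vertex of d and
   traversing d first. *)
Definition face_label d : word X :=
  [seq lab x | x <- orbit (@face_next M) d].

(* Let f and f' be the faces of d and of opp d, f <> f'.  The boundary of f'
   read from face_next (opp d) ends with opp d, so that its inverse is the
   label of f' read with the opposite orientation, traversing d first. *)
Definition reducible : Prop :=
  exists d, [/\ ~~ removed d, ~~ removed (opp d),
    ~~ fconnect (@face_next M) d (opp d)
  & face_label d = inv_word (face_label (face_next (opp d)))].

Definition reduced : Prop := ~ reducible.

(* Vertices are given by any of the darts issuing from them. *)
Definition degree d : nat := order (@turn M) d.

(* The boundary of the diagram is the union of the boundaries of the removed
   faces. *)
Definition interior d : bool :=
  [forall x, fconnect (@turn M) d x ==> ~~ removed x].

(* The vertices erased when edges are merged. *)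
Definition erased d : bool := interior d && (degree d == 2)%N.

(* The number of original edges in the merged edge starting with d, when the
   initial vertex of d is not erased: at a vertex of degree 2 the merged edge
   goes on with face_next, up to the first vertex that is not erased. *)
Definition edge_length d : nat :=
  (find (predC erased) (orbit (@face_next M) (face_next d))).+1.

Definition relator_length d : nat := size (face_label d).

(* The corners at the vertex of d are the pairs (x, turn x) with x in its
   orbit; such a corner lies in the face of turn x = face_next (opp x). *)
Definition dF' d : rat :=
  \sum_(x <- orbit (@turn M) d)
    (edge_length x + edge_length (turn x))%:R / (relator_length (turn x))%:R.

End Diagram.

Definition tau' X (R : word X -> Prop) : Prop :=
  forall M : diagram R, reduced M ->
  forall d : M, interior d -> (degree d != 2)%N ->
    dF' d <= (degree d)%:R - 2%:R.

(* Main.v *)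
From mathcomp Require Import all_boot all_order all_algebra.
From mathcomp Require Import ring lra zify.
From mathcomp Require Import boolp.
Require Import Defs.

(** A word [W] that is trivial in [G] bounds a planar diagram whose faces carry
    relators, and the hypotheses give such a diagram a metric of nonpositive
    curvature.  Suppose that all relators have length at least [n >= 2].

    Curvature.  Give the corner of a face of length [l] between edges of lengths
    [l1] and [l2] the angle [1 - (l1 + l2) / l], in units of pi.  Then the angles
    of a face with [k] corners sum up to [k - 2], as in a Euclidean polygon
    ([face_angle]), and condition tau' says that the angles at an interior
    vertex sum up to at least 2.  Interior edges are labelled by pieces, so that
    C'(1/2) makes all angles nonnegative and bounds the curvature of a boundary
    vertex by [2 / n] for each time that the boundary passes it
    ([vertex_angle]).  The total curvature is 2, by Euler's formula, and hence
    the boundary has length at least [n] ([boundary_length]).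

    Diagrams.  One needs a reduced diagram on the sphere with one removed face
    whose boundary label is [W].  A derivation of [W] from the empty word is
    followed step by step ([area_disk]): cyclic lists of darts are spiked, folded
    and split, and what is remembered of planarity is that labels and cochains
    on the edges behave as on a simply connected complex ([disk]).  Vanishing of
    the first cohomology modulo 2 gives back Euler's formula by comparing the
    ranks of the two incidence matrices ([euler_of_exact]).

    Reducedness.  Take [W] nontrivial in the free group and shorter than [n],
    first with the least number of relators and then of the least length.  If
    two faces are mirror images across an edge, changing the label of that one
    edge makes both of them trivial, and the relation between the outer label
    and the labels of the faces shows that [W] needs two relators fewer
    ([disk_reduced]).  In the same way the diagram is connected
    ([sub_connected]).  By the second minimality [W] is cyclically reduced, so
    that no boundary vertex has degree 1.  The length bound now contradicts the
    choice of [W] ([short_word_trivial]).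

    If some relators have length 1, the last statement does not follow at once;
    their letters are erased first. *)

Set Implicit Arguments.
Unset Strict Implicit.
Unset Printing Implicit Defensive.

Import Order.TTheory GRing.Theory Num.Theory.

(** * Words *)

Section Words.

Variable X : Type.
Implicit Types (a b : letter X) (u v w r s : word X) (R : word X -> Prop).

Lemma inv_letterK : involutive (@inv_letter X).
Proof. by case=> x []. Qed.

Lemma inv_letter_neq a : inv_letter a <> a.
Proof. by case: a => x [] []. Qed.

Lemma inv_word_cat u v : inv_word (u ++ v) = inv_word v ++ inv_word u.
Proof. by rewrite /inv_word map_cat rev_cat. Qed.

Lemma inv_word_cons a w : inv_word (a :: w) = inv_word w ++ [:: inv_letter a].
Proof. by rewrite /inv_word /= rev_cons -cats1. Qed.

Lemma inv_wordK : involutive (@inv_word X).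
Proof.
by move=> w; rewrite /inv_word map_rev revK -map_comp (eq_map inv_letterK) map_id.
Qed.

Lemma size_inv_word w : size (inv_word w) = size w.
Proof. by rewrite size_rev size_map. Qed.

Lemma inv_word_rot k w : exists j, inv_word (rot k w) = rot j (inv_word w).
Proof.
exists (size (inv_word (drop k w))).
by rewrite {1}/rot inv_word_cat -{4}(cat_take_drop k w) inv_word_cat rot_size_cat.
Qed.

Lemma cyclic_perm_rot w w' k : cyclic_perm w w' -> cyclic_perm w (rot k w').
Proof.
by case=> i ->; exists (rot_add w i k); rewrite rot_rot_add.
Qed.

Lemma Rstar_rot R k r : Rstar R r -> Rstar R (rot k r).
Proof.
by case=> q Rq [] /(cyclic_perm_rot k) ?; exists q => //; [left | right].
Qed.

Lemma Rstar_inv R r : Rstar R r -> Rstar R (inv_word r).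
Proof.
case=> q Rq [] [k ->]; exists q => //.
  by right; case: (inv_word_rot k q) => j ->; exists j.
by left; case: (inv_word_rot k (inv_word q)) => j ->; exists j; rewrite inv_wordK.
Qed.

Lemma Rstar_size R r : Rstar R r -> exists2 q, R q & size q = size r.
Proof.
by case=> q Rq [] [k ->]; exists q; rewrite // size_rot ?size_inv_word.
Qed.

Lemma inv_freely_reduced w : freely_reduced w -> freely_reduced (inv_word w).
Proof.
move=> wred u v a wE.
have: w = inv_word (u ++ [:: a; inv_letter a] ++ v) by rewrite -wE inv_wordK.
rewrite 2!inv_word_cat -catA {2}/inv_word /= /rev /= inv_letterK.
exact: wred.
Qed.

Lemma word_eq_ctx R u v w w' :
  word_eq R w w' -> word_eq R (u ++ w ++ v) (u ++ w' ++ v).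
Proof.
elim=> [?|? ? _|? w2 ? _ + _|u' v' a|u' v' r Rr].
- exact: word_eq_refl.
- exact: word_eq_sym.
- exact: word_eq_trans.
- by have := word_eq_cancel R (u ++ u') (v' ++ v) a; rewrite -!catA.
by have := word_eq_relator (u ++ u') (v' ++ v) Rr; rewrite -!catA.
Qed.

Lemma word_eq_cancel_word R u w v : word_eq R (u ++ w ++ inv_word w ++ v) (u ++ v).
Proof.
elim: w u v => [|a w IHw] u v; first exact: word_eq_refl.
have := IHw (rcons u a) (inv_letter a :: v).
rewrite inv_word_cons -cats1 -!catA /= => h.
exact: word_eq_trans h (word_eq_cancel R u v a).
Qed.

Lemma free_eq_rot u v : free_eq (u ++ v) [::] -> free_eq (v ++ u) [::].
Proof.
move=> /(word_eq_ctx v (inv_word v)); rewrite /= => uv1.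
have := word_eq_cancel_word (fun _ => False) (v ++ u) v [::].
rewrite !cats0 -!catA => vu.
have := word_eq_cancel_word (fun _ => False) [::] v [::]; rewrite !cats0 /= => v1.
apply: word_eq_trans v1; apply: word_eq_trans uv1; rewrite -catA.
exact: word_eq_sym.
Qed.

(** The exponent sum is an invariant of equality in the free group. *)
Lemma free_eq_letter a : ~ free_eq [:: a] [::].
Proof.
pose sgn (w : word X) : int :=
  (\sum_(b <- w) (if b.2 then -1 else 1))%R.
have sgnP w w' : free_eq w w' -> sgn w = sgn w'.
  elim=> // [? ? ? _ -> //|u v b].
  rewrite /sgn !big_cat /= !big_cons big_nil /=; case: b.2 => /=; lia.
by move/sgnP; rewrite /sgn big_seq1 big_nil; case: a.2.
Qed.

End Words.

(** * Area *)

(** [area R k w] means that [w] is a product of [k] conjugates of elements of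
    [R*] in the free group.  Relators are deleted and never inserted: reading a
    derivation from the empty word to [w], each of the three moves is then a
    surgery on the outer face of a planar diagram that can be described without
    looking at the rest of the diagram.  The area is minimized to make a diagram
    reduced and connected. *)
Inductive area X (R : word X -> Prop) : nat -> word X -> Prop :=
| area_nil : area R 0 [::]
| area_spike k u v a :
    area R k (u ++ v) -> area R k (u ++ [:: a; inv_letter a] ++ v)
| area_fold k u v a :
    area R k (u ++ [:: a; inv_letter a] ++ v) -> area R k (u ++ v)
| area_relator k u v r :
    Rstar R r -> area R k (u ++ r ++ v) -> area R k.+1 (u ++ v).

Section Area.

Variables (X : Type) (R : word X -> Prop).
Implicit Types (a b : letter X) (u v w r s : word X).

Lemma area_free_eq w w' k : free_eq w w' -> area R k w <-> area R k w'.
Proof.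
elim=> // [? ? _ ->//|? ? ? _ -> _ ->//|u v a]; split; first exact: area_fold.
exact: area_spike.
Qed.

Lemma area_insert k u w v : area R k (u ++ v) -> area R k (u ++ w ++ inv_word w ++ v).
Proof. by move=> ?; apply/(area_free_eq k (word_eq_cancel_word _ u w v)). Qed.

Lemma area_delete k u w v : area R k (u ++ w ++ inv_word w ++ v) -> area R k (u ++ v).
Proof. by move=> ?; apply/(area_free_eq k (word_eq_cancel_word _ u w v)). Qed.

(** Conjugating a whole derivation costs nothing. *)
Lemma area_rot k u v : area R k (u ++ v) -> area R k (v ++ u).
Proof.
suff conj w c : area R k w -> area R k (c ++ w ++ inv_word c).
  move=> /(conj _ v); rewrite -!catA => vuv.
  by rewrite -[v ++ u]cats0; apply: (@area_delete _ _ v); rewrite cats0 -!catA.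
elim=> {k w} [|k u' v' a|k u' v' a|k u' v' r Rr].
- by rewrite /=; have := @area_insert 0 [::] c [::] (area_nil R); rewrite !cats0.
- by move=> _; rewrite -!catA catA => /(@area_spike _ R k _ _ a); rewrite -!catA.
- by move=> _; rewrite -!catA catA => /(@area_fold _ R k _ _ a); rewrite -!catA.
by move=> _; rewrite -!catA catA => /(area_relator Rr); rewrite -!catA.
Qed.

Lemma word_eq_area w w' : word_eq R w w' ->
  (exists k, area R k w) <-> (exists k, area R k w').
Proof.
elim=> // [? ? _ ->//|? ? ? _ -> _ ->//|u v a|u v r Rr].
  by split=> -[k wk]; exists k; [exact: area_fold wk | exact: area_spike].
have Rr' : Rstar R r by exists r => //; left; exists 0; rewrite rot0.
split=> -[k wk]; exists k.+1; first exact: area_relator wk.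
move: wk => /(@area_insert k u r v); rewrite catA.
by move/(area_relator (Rstar_inv Rr')); rewrite -catA.
Qed.

End Area.

(** * Sewing planar diagrams *)

(** [h] is a cochain modulo 2 on the darts and [u] gives values to their initial
    vertices: along a face, [u] has to grow by the values of [h]. *)
Definition flows (u h : nat -> 'F_2) : rel nat :=
  fun d e => (u e == u d + h d)%R.

Definition read X (m : nat -> word X) (l : seq nat) : word X := flatten (map m l).

(** A planar diagram that may be pinched and disconnected: the darts are natural
    numbers, [B] lists those of the outer face in cyclic order, the members of
    [L] are the other faces, and [opp] sews the edges of all these polygons
    together in pairs.

    Planarity is recorded by two properties which replace simple connectivity;
    every surgery below preserves them, because a function on the edges after
    surgery can be pulled back to one before it.
    - [disk_area]: whatever words [m] are put on the edges, the outer label is a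
      product of conjugates of the labels of the other faces, each taken once.
      Here [c] selects the labels that are counted, the others being trivial.
      The freedom in [m] makes it possible to see that a reducible diagram does
      not have minimal area.
    - [disk_exact]: the first cohomology modulo 2 vanishes.  For a connected
      diagram this is Euler's formula. *)
Record disk X (R : word X -> Prop) (B : seq nat) (L : seq (seq nat))
    (opp : nat -> nat) (lab : nat -> letter X) : Prop := Disk {
  disk_uniq : uniq (B ++ flatten L);
  disk_opp : {in B ++ flatten L, forall d,
    [/\ opp d \in B ++ flatten L, opp (opp d) = d & opp d <> d]};
  disk_lab : {in B ++ flatten L, forall d, lab (opp d) = inv_letter (lab d)};
  disk_face : {in L, forall l, Rstar R (map lab l)};
  disk_area : forall (m : nat -> word X) (c : pred (seq nat)),
    {in B ++ flatten L, forall d, m (opp d) = inv_word (m d)} ->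
    {in L, forall l,
      if c l then Rstar R (read m l) else free_eq (read m l) [::]} ->
    area R (count c L) (read m B);
  disk_exact : forall h : nat -> 'F_2,
    {in B ++ flatten L, forall d, h (opp d) = h d} ->
    {in L, forall l, (\sum_(d <- l) h d = 0)%R} ->
    exists2 u : nat -> 'F_2,
      {in B ++ flatten L, forall d, u (opp d) = (u d + h d)%R}
    & {in B :: L, forall l, cycle (flows u h) l}
}.

Section Disk.

Variables (X : Type) (R : word X -> Prop).
Implicit Types (B l : seq nat) (L : seq (seq nat)) (opp : nat -> nat).
Implicit Types (lab : nat -> letter X) (u h : nat -> 'F_2).

Lemma F2_addxx (x : 'F_2) : (x + x = 0)%R.
Proof. by apply: addrr_pchar2; rewrite pchar_Fp. Qed.

Lemma read_cat (m : nat -> word X) l l' : read m (l ++ l') = read m l ++ read m l'.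
Proof. by rewrite /read map_cat flatten_cat. Qed.

Lemma eq_in_read (m m' : nat -> word X) l : {in l, m =1 m'} -> read m l = read m' l.
Proof. by move=> mm'; rewrite /read; congr flatten; apply/eq_in_map. Qed.

Lemma read_lab lab l : read (fun d => [:: lab d]) l = map lab l.
Proof. by elim: l => //= d l IHl; rewrite -IHl. Qed.

Lemma flows_rcons u h x s z z' : u z = u z' ->
  path (flows u h) x (rcons s z) = path (flows u h) x (rcons s z').
Proof. by move=> zz'; rewrite !rcons_path {2 4}/flows zz'. Qed.

Lemma flows_spike u h x y s : h y = h x -> u y = (u x + h x)%R ->
  cycle (flows u h) (x :: y :: s) =
  cycle (flows u h) s && (if s is q :: _ then u x == u q else true).
Proof.
move=> hxy uxy.
have yx z : flows u h y z = (u x == u z).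
  by rewrite /flows uxy hxy -addrA F2_addxx addr0 eq_sym.
case: s => [|q s] /=; rewrite {1}/flows uxy eqxx yx ?eqxx //=.
rewrite andbC; case: eqP => [xq|]; last by rewrite !andbF.
by rewrite !andbT; apply: flows_rcons.
Qed.

Lemma flows_sum u h x s z : path (flows u h) x (rcons s z) ->
  (u z = u x + \sum_(d <- x :: s) h d)%R.
Proof.
elim: s x => [|y s IHs] x /=; first by rewrite andbT big_seq1 => /eqP.
by rewrite big_cons addrA => /andP[/eqP <- /IHs].
Qed.

Lemma flows_cat u h l s : cycle (flows u h) (l ++ s) -> (\sum_(d <- l) h d = 0)%R ->
  cycle (flows u h) l /\ cycle (flows u h) s.
Proof.
case: l => [|x l] // + lsum; case: s => [|q s]; first by rewrite cats0.
rewrite /= rcons_cat -cat_rcons cat_path last_rcons => /andP[lq sx].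
have qx : u q = u x by rewrite (flows_sum lq) lsum addr0.
by rewrite (flows_rcons _ _ _ qx) in lq; rewrite -(flows_rcons _ _ _ qx) in sx.
Qed.

Lemma disk0 lab opp : disk R [::] [::] opp lab.
Proof.
split=> // [m c _ _|h _ _]; first exact: area_nil.
by exists (fun _ => 0%R) => // l; rewrite inE => /eqP->.
Qed.

(** A new edge is attached by one end at a corner of the outer face; its two
    sides are [x] and [y].  The potential extends along it from that corner,
    whose value [u0] is that of the next dart [q], or arbitrary if the outer face
    was empty. *)
Lemma disk_spike B1 B2 L opp lab a : disk R (B1 ++ B2) L opp lab ->
  exists x y opp' lab', disk R (B1 ++ [:: x; y] ++ B2) L opp' lab' /\
    map lab' (B1 ++ [:: x; y] ++ B2) = map lab B1 ++ [:: a; inv_letter a] ++ map lab B2.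
Proof.
case=> Du Do Dl Df Da De.
set S := (B1 ++ B2) ++ flatten L in Du Do Dl Df Da De *.
pose x := (\sum_(d <- S) d).+1; pose y := x.+1.
have ltx d : d \in S -> d < x.
  by move=> dS; rewrite ltnS (big_rem d) //= leq_addr.
have neqx d : d \in S -> (d == x) = false by move/ltx; case: ltngtP.
have neqy d : d \in S -> (d == y) = false by rewrite /y; move/ltx; lia.
have yx : (y == x) = false by rewrite /y; lia.
pose opp' d := if d == x then y else if d == y then x else opp d.
pose lab' d := if d == x then a else if d == y then inv_letter a else lab d.
have memS d : (d \in (B1 ++ [:: x; y] ++ B2) ++ flatten L) = [|| d == x, d == y | d \in S].
  by rewrite /S !mem_cat !inE; case: (d == x); case: (d == y);
    case: (d \in B1); case: (d \in B2).
have subS d l : l \in L -> d \in l -> d \in S.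
  by move=> lL dl; rewrite mem_cat; apply/orP; right; apply/flattenP; exists l.
have lab'E l : {subset l <= S} -> map lab' l = map lab l.
  move=> lS; apply/eq_in_map => d /lS dS.
  by rewrite /lab' neqx ?neqy.
have B1S : {subset B1 <= S} by move=> d dB; rewrite !mem_cat dB.
have B2S : {subset B2 <= S} by move=> d dB; rewrite !mem_cat dB orbT.
have opp'E d : d \in S -> opp' d = opp d.
  by move=> dS; rewrite /opp' neqx ?neqy.
exists x, y, opp', lab'; split; last first.
  by rewrite !map_cat (lab'E B1) // (lab'E B2) //= /lab' !(eqxx, yx).
split.
- have: uniq ([:: x; y] ++ S).
    rewrite cat_uniq Du andbT; apply/andP; split; first by rewrite /= inE eq_sym yx.
    apply/hasPn => d dS; by rewrite !inE neqx ?neqy.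
  rewrite -(perm_uniq (s1 := (B1 ++ [:: x; y] ++ B2) ++ flatten L)) //.
  by rewrite /S !catA perm_cat2r perm_cat2r perm_catC.
- move=> d; rewrite memS => /or3P[/eqP->|/eqP->|dS].
  + by rewrite /opp' !(eqxx, yx) memS eqxx orbT; split=> //; apply/eqP; rewrite yx.
  + by rewrite /opp' !(eqxx, yx) memS eqxx; split=> //; apply/eqP; rewrite eq_sym yx.
  have [odS ood od] := Do d dS.
  by rewrite !opp'E // memS odS !orbT.
- move=> d; rewrite memS => /or3P[/eqP->|/eqP->|dS].
  + by rewrite /opp' /lab' !(eqxx, yx).
  + by rewrite /opp' /lab' !(eqxx, yx) inv_letterK.
  have [odS _ _] := Do d dS.
  by rewrite opp'E // /lab' !neqx ?neqy // Dl.
- by move=> l lL; rewrite lab'E; [apply: Df | move=> d; apply: subS].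
- move=> m c mo mL.
  have m1 : {in S, forall d, m (opp d) = inv_word (m d)}.
    by move=> d dS; rewrite -opp'E // mo // memS dS !orbT.
  have := Da m c m1 mL; rewrite !read_cat => /(area_insert (m x)).
  rewrite /read /= cats0 -mo ?memS ?eqxx // /opp' eqxx.
  by rewrite -catA.
move=> h ho hL.
have ho1 : {in S, forall d, h (opp d) = h d}.
  by move=> d dS; rewrite -opp'E // ho // memS dS !orbT.
have [u uo uL] := De h ho1 hL.
have hyx : h y = h x by rewrite -[in LHS](_ : opp' x = y) ?ho ?memS ?eqxx // /opp' eqxx.
pose u0 := if B2 ++ B1 is q :: _ then u q else 0%R.
pose u' d := if d == x then u0 else if d == y then (u0 + h x)%R else u d.
have u'E d : d \in S -> u' d = u d by move=> dS; rewrite /u' neqx ?neqy.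
have u'C l : {subset l <= S} -> cycle (flows u' h) l = cycle (flows u h) l.
  move=> lS; apply: (@eq_in_cycle _ (mem S)); last exact/allP.
  by move=> d e dS eS; rewrite /flows !u'E.
have u'y : (u' y = u' x + h x)%R by rewrite /u' !(eqxx, yx).
exists u'.
  move=> d; rewrite memS => /or3P[/eqP->|/eqP->|dS].
  + by rewrite -u'y /opp' eqxx.
  + by rewrite u'y hyx -addrA F2_addxx addr0 /opp' yx eqxx.
  by have [odS _ _] := Do d dS; rewrite opp'E // !u'E // uo.
move=> l; rewrite inE => /orP[/eqP->|lL]; last first.
  by rewrite u'C ?uL ?inE ?lL ?orbT // => d; apply: subS.
rewrite cycle_catC -catA [[:: x; y] ++ _]/= flows_spike //.
rewrite u'C; last by move=> d; rewrite mem_cat => /orP[/B2S|/B1S].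
rewrite cycle_catC uL ?mem_head //=.
case E: (B2 ++ B1) => [|q s] //; rewrite (u'E q); last first.
  have: q \in B2 ++ B1 by rewrite E mem_head.
  by rewrite mem_cat => /orP[/B2S|/B1S].
by rewrite /u' eqxx /u0 E.
Qed.

(** Two consecutive edges [x] and [y] of the outer face with inverse labels are
    sewn together.  If their outer ends coincide, this pinches the diagram: one
    vertex becomes two, and a sphere may come off.  No case distinction is
    needed, since both universal properties of a disk only refer to functions on
    the edges. *)
Lemma disk_fold B1 B2 L opp lab x y :
  disk R (B1 ++ [:: x; y] ++ B2) L opp lab -> lab y = inv_letter (lab x) ->
  exists opp', disk R (B1 ++ B2) L opp' lab.
Proof.
case=> Du Do Dl Df Da De lyx.
set S := (B1 ++ [:: x; y] ++ B2) ++ flatten L in Du Do Dl Df Da De *.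
set S' := (B1 ++ B2) ++ flatten L.
have Du' : uniq ([:: x; y] ++ S').
  rewrite -(perm_uniq (s1 := S)) //.
  by rewrite /S /S' !catA perm_cat2r perm_cat2r perm_catC.
have [yx xS' yS'] : [/\ y != x, x \notin S' & y \notin S'].
  by move: Du'; rewrite /= inE negb_or eq_sym => /and3P[/andP[-> ->] -> _].
have memS d : (d \in S) = [|| d == x, d == y | d \in S'].
  by rewrite /S /S' !mem_cat !inE; case: (d == x); case: (d == y);
    case: (d \in B1); case: (d \in B2).
have S'S d : d \in S' -> d \in S by rewrite memS => ->; rewrite !orbT.
have xS : x \in S by rewrite memS eqxx.
have yS : y \in S by rewrite memS eqxx orbT.
have neqx d : d \in S' -> (d == x) = false by case: eqP => // ->; rewrite (negPf xS').
have neqy d : d \in S' -> (d == y) = false by case: eqP => // ->; rewrite (negPf yS').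
have memS' d : d \in S -> d != x -> d != y -> d \in S'.
  by rewrite memS => /or3P[->|->|].
have subS d l : l \in L -> d \in l -> d \in S'.
  by move=> lL dl; rewrite mem_cat; apply/orP; right; apply/flattenP; exists l.
have [oxS oox ox] := Do x xS; have [oyS ooy oy] := Do y yS.
pose opp' d := if d == opp x then opp y else if d == opp y then opp x else opp d.
have opp_eq d e : d \in S -> e \in S -> (opp d == e) = (d == opp e).
  move=> dS eS; have [_ ood _] := Do d dS; have [_ ooe _] := Do e eS.
  by apply/eqP/eqP => [<-|->].
have xy : x != y by rewrite eq_sym.
have oox' : opp' (opp x) = opp y by rewrite /opp' eqxx.
have ooy' : opp' (opp y) = opp x.
  by rewrite /opp' eqxx; case: eqP => // oyx; rewrite -[in LHS]oyx.
(* The two old edges inherit the value of the edge that they become.  The value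
   at y is the inverse of that at x and not the value of m' at opp y, because x
   and y may be the two sides of one edge, which disappears. *)
have ext (T : Type) (inv : T -> T) (m' : nat -> T) : involutive inv ->
    {in S', forall d, m' (opp' d) = inv (m' d)} ->
    exists m, [/\ {in S, forall d, m (opp d) = inv (m d)}, {in S', m =1 m'}
      & m y = inv (m x)].
  move=> invK m'o; pose m d := if d == x then inv (m' (opp x)) else
    if d == y then m' (opp x) else m' d.
  have mx : m x = inv (m' (opp x)) by rewrite /m eqxx.
  have my : m y = m' (opp x) by rewrite /m (negPf yx) eqxx.
  have mE d : d \in S' -> m d = m' d by move=> dS'; rewrite /m neqx ?neqy.
  exists m; split=> //; last by rewrite mx invK.
  have [oxy | /eqP oxy] := opp x =P y.
    have oyx : opp y = x by rewrite -oxy.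
    move=> d; rewrite memS => /or3P[/eqP->|/eqP->|dS'].
    + by rewrite oxy mx my invK oxy.
    + by rewrite oyx mx my.
    have dS := S'S d dS'; have [odS _ _] := Do d dS.
    have odS' : opp d \in S'.
      by apply: memS' => //; rewrite opp_eq // ?oxy ?oyx ?neqx ?neqy.
    rewrite !mE // -m'o // /opp' oxy oyx neqx ?neqy //.
  have oxS' : opp x \in S' by apply: memS' => //; apply/eqP.
  have oyS' : opp y \in S'.
    by apply: memS' => //; [rewrite opp_eq // eq_sym | apply/eqP].
  move=> d; rewrite memS => /or3P[/eqP->|/eqP->|dS'].
  + by rewrite mx invK mE.
  + by rewrite my mE // -m'o // oox'.
  have dS := S'S d dS'; have [odS _ _] := Do d dS.
  have [dx | /eqP dx] := d =P opp x; first by rewrite dx oox mx mE.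
  have [dy | /eqP dy] := d =P opp y.
    by rewrite dy ooy my mE // -m'o // ooy'.
  rewrite !mE //; last by apply: memS' => //; rewrite opp_eq.
  by rewrite -m'o // /opp' (negPf dx) (negPf dy).
exists opp'; split.
- by move: Du'; rewrite cat_uniq => /and3P[].
- move=> d dS'; have dS := S'S d dS'; have [odS ood od] := Do d dS.
  rewrite /opp'; case: (d =P opp x) => [dx|/eqP dx].
    have oyx : opp y != x by rewrite opp_eq // -dx eq_sym neqy.
    have oxy : opp y != opp x.
      by apply: contra xy => /eqP oxy; rewrite -oox -oxy ooy.
    rewrite (negPf oxy) eqxx; split=> //; last by rewrite dx; apply/eqP.
    by apply: memS' => //; apply/eqP.
  case: (d =P opp y) => [dy|/eqP dy].
    have oxy : opp x != y by rewrite opp_eq // -dy eq_sym neqx.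
    rewrite eqxx; split=> //; last by rewrite dy; apply/eqP; rewrite -dy eq_sym.
    by apply: memS' => //; apply/eqP.
  rewrite [_ == opp x]opp_eq // oox [_ == opp y]opp_eq // ooy neqx ?neqy //.
  by split=> //; apply: memS' => //; rewrite opp_eq.
- move=> d dS'; rewrite /opp'.
  case: (d =P opp x) => [->|_]; first by rewrite !Dl // lyx.
  case: (d =P opp y) => [->|_]; last exact/Dl/S'S.
  by rewrite !Dl // lyx inv_letterK.
- exact: Df.
- move=> m' c m'o m'L.
  have [m [mo mE mxy]] := ext _ _ m' (@inv_wordK X) m'o.
  have readE l : {subset l <= S'} -> read m l = read m' l.
    by move=> lS; apply: eq_in_read => d /lS /mE.
  have mL : {in L, forall l,
      if c l then Rstar R (read m l) else free_eq (read m l) [::]}.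
    move=> l lL; rewrite readE; first exact: m'L.
    by move=> d; apply: subS.
  have := Da m c mo mL; rewrite !read_cat [read m [:: x; y]]/read /= cats0.
  rewrite mxy -catA => /area_delete.
  by rewrite !readE // => d dB; rewrite !mem_cat dB ?orbT.
move=> h' h'o h'L.
have [h [ho hE hxy]] := ext _ id h' (fun _ => erefl) h'o.
have hL : {in L, forall l, (\sum_(d <- l) h d = 0)%R}.
  move=> l lL; rewrite -[RHS](h'L l lL); apply: eq_big_seq => d dl.
  by rewrite hE //; apply: subS dl.
have [u uo uL] := De h ho hL.
have flowsE l : {subset l <= S'} -> cycle (flows u h') l = cycle (flows u h) l.
  move=> lS; apply: (@eq_in_cycle _ (mem S')); last exact/allP.
  by move=> d e dS eS; rewrite /flows hE.
have := uL _ (mem_head _ _); rewrite cycle_catC -catA => uB.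
have uxy : (u y = u x + h x)%R by move: uB => /= /andP[/eqP].
have uoxy : (u (opp y) = u (opp x) + h (opp x))%R.
  rewrite !uo // ho // hxy uxy -!addrA; congr (_ + _)%R.
exists u.
  move=> d dS'; have dS := S'S d dS'; rewrite -hE // /opp'.
  case: (d =P opp x) => [->|_] //.
  case: (d =P opp y) => [->|_]; last exact: uo.
  by rewrite uoxy [h (opp y)]ho // hxy -[h x]ho // -addrA F2_addxx addr0.
move=> l; rewrite inE => /orP[/eqP->|lL]; last first.
  by rewrite flowsE ?uL ?inE ?lL ?orbT // => d; apply: subS.
have BS d : d \in B1 ++ B2 -> d \in S' by rewrite [d \in S']mem_cat => ->.
rewrite flowsE // cycle_catC.
by move: uB; rewrite [[:: x; y] ++ _]/= flows_spike // => /andP[].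
Qed.

(** A piece of the outer boundary whose label is a relator is closed up to a new
    face, and the rest remains as outer boundary.  A cochain that vanishes on the
    new face has a potential that returns to its initial value along the piece,
    so that the potential of the old diagram serves for the new one. *)
Lemma disk_split B1 B2 L opp lab l :
  disk R (B1 ++ l ++ B2) L opp lab -> Rstar R (map lab l) ->
  disk R (B1 ++ B2) (l :: L) opp lab.
Proof.
case=> Du Do Dl Df Da De ll.
have memS d : (d \in (B1 ++ B2) ++ flatten (l :: L)) = (d \in (B1 ++ l ++ B2) ++ flatten L).
  by rewrite /= !mem_cat; case: (d \in l); case: (d \in B1); case: (d \in B2).
split.
- rewrite -(perm_uniq (s1 := (B1 ++ l ++ B2) ++ flatten L)) //= !catA perm_cat2r.
  by rewrite -!catA perm_cat2l perm_catC.
- by move=> d; rewrite !memS; apply: Do.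
- by move=> d; rewrite !memS; apply: Dl.
- by move=> l'; rewrite inE => /orP[/eqP->|/Df].
- move=> m c mo mL.
  have mo' : {in (B1 ++ l ++ B2) ++ flatten L, forall d, m (opp d) = inv_word (m d)}.
    by move=> d; rewrite -memS; apply: mo.
  have := Da m c mo' (fun l' lL => mL l' (mem_behead (s := l :: L) lL)).
  have := mL l (mem_head _ _); rewrite /= !read_cat.
  case: (c l) => [rl | rl].
    exact: area_relator.
  by move/(area_free_eq R _ (word_eq_ctx _ _ rl)).
move=> h ho hL.
have ho' : {in (B1 ++ l ++ B2) ++ flatten L, forall d, h (opp d) = h d}.
  by move=> d; rewrite -memS; apply: ho.
have [u uo uL] := De h ho' (fun l' lL => hL l' (mem_behead (s := l :: L) lL)).
exists u; first by move=> d; rewrite memS; apply: uo.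
have := uL _ (mem_head _ _); rewrite cycle_catC -catA => uB.
have [lc Bc] : cycle (flows u h) l /\ cycle (flows u h) (B2 ++ B1).
  by apply: flows_cat uB _; apply: hL; apply: mem_head.
move=> l'; rewrite !inE => /or3P[/eqP->|/eqP->//|lL]; first by rewrite cycle_catC.
by apply: uL; rewrite inE lL orbT.
Qed.

Lemma area_disk k w (x0 : letter X) : area R k w ->
  exists B L opp lab, [/\ disk R B L opp lab, map lab B = w & size L = k].
Proof.
have split_map lab B (u v : word X) : map lab B = u ++ v ->
    exists B1 B2, [/\ B = B1 ++ B2, map lab B1 = u & map lab B2 = v].
  move=> Buv; exists (take (size u) B), (drop (size u) B).
  by rewrite cat_take_drop map_take map_drop Buv take_size_cat // drop_size_cat.
elim=> {k w} [|k u v a _|k u v a _|k u v r rR _].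
- by exists [::], [::], id, (fun _ => x0); split=> //; apply: disk0.
- move=> [B [L [opp [lab [DB /split_map[B1 [B2 [BE <- <-]]] Lk]]]]].
  rewrite BE in DB; have [x [y [opp' [lab' [D' B'E]]]]] := disk_spike a DB.
  by exists (B1 ++ [:: x; y] ++ B2), L, opp', lab'.
- move=> [B [L [opp [lab [DB /split_map[B1 [B' [BE <-]]]]]]]].
  move=> /split_map[l [B2 [B'E la <-]]] Lk.
  case: l la B'E => [|x [|y [|? ?]]] // [xa ya] B'E.
  rewrite BE B'E in DB; rewrite -xa in ya; have [opp' D'] := disk_fold DB ya.
  by exists (B1 ++ B2), L, opp', lab; rewrite map_cat.
move=> [B [L [opp [lab [DB /split_map[B1 [B' [BE <-]]]]]]]].
move=> /split_map[l [B2 [B'E lr <-]]] Lk.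
rewrite -lr in rR; rewrite BE B'E in DB; have D' := disk_split DB rR.
by exists (B1 ++ B2), (l :: L), opp, lab; rewrite map_cat /= Lk.
Qed.

End Disk.

(** * Euler's formula from exactness *)

Section Euler.

Local Open Scope ring_scope.

Lemma orbit_index (D : finType) (f : D -> D) : injective f ->
  exists (r : D -> 'I_(fcard f D)) (s : 'I_(fcard f D) -> D),
    cancel s r /\ forall d e, (r d == r e) = fconnect f d e.
Proof.
move=> finj; have fsym := fconnect_sym finj.
have rootA d : froot f d \in predI (froots f) (mem D).
  by rewrite inE /= (roots_root fsym) andbT.
pose r d := enum_rank_in (rootA d) (froot f d).
have rK d : enum_val (r d) = froot f d by rewrite enum_rankK_in.
exists r, enum_val; split=> [i|d e].
  apply: enum_val_inj; rewrite rK.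
  by have := enum_valP i; rewrite inE => /andP[/eqP].
by rewrite -(inj_eq enum_val_inj) !rK (root_connect fsym).
Qed.

Variables (D : finType) (opp : D -> D).
Hypotheses (oppK : involutive opp) (opp_neq : forall d, opp d != d).

Lemma fconnect_opp d e : fconnect opp d e = (e == d) || (e == opp d).
Proof.
apply/idP/orP => [/iter_findex <-|[/eqP->|/eqP->]]; last 2 first.
- exact: connect0.
- exact: fconnect1.
elim: (findex _ _ _) => [|n IHn] /=; first by left.
by case: IHn => /eqP->; [right | rewrite oppK; left].
Qed.

Variables (rE : D -> 'I_(fcard opp D)) (sE : 'I_(fcard opp D) -> D).
Hypotheses (sEK : cancel sE rE) (rEP : forall d e, (rE d == rE e) = fconnect opp d e).

Lemma rE_opp d : rE (opp d) = rE d.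
Proof. by apply/eqP; rewrite eq_sym rEP fconnect1. Qed.

Lemma dart_cases d : d = sE (rE d) \/ d = opp (sE (rE d)).
Proof.
have: rE (sE (rE d)) == rE d by rewrite sEK.
by rewrite rEP fconnect_opp => /orP[]/eqP; [left | right].
Qed.

Lemma sum_edge_darts (T : nmodType) (g : D -> T) :
  \sum_d g d = \sum_j (g (sE j) + g (opp (sE j))).
Proof.
rewrite (partition_big rE xpredT) //=; apply: eq_bigr => j _.
have rEj d : (rE d == j) = (d == sE j) || (d == opp (sE j)).
  by rewrite -{1}(sEK j) eq_sym rEP fconnect_opp.
rewrite (bigD1 (sE j)) ?rEj ?eqxx //=; congr (_ + _).
rewrite (bigD1 (opp (sE j))) ?rEj ?eqxx ?orbT ?opp_neq //=.
by rewrite big1 ?addr0 // => d; rewrite rEj; case: (d == sE j); case: (_ == _).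
Qed.

(** The boundary operator modulo 2 between the edges and the orbits of [f]:
    the columns are indexed by edges, and the column of an edge adds up the two
    orbits that it meets. *)
Definition incidence n (r : D -> 'I_n) : 'M['F_2]_(n, fcard opp D) :=
  \matrix_(i, j) ((r (sE j) == i)%:R + (r (opp (sE j)) == i)%:R).

Lemma mul_incidence n (r : D -> 'I_n) (w : 'rV_n) (i : 'I_1) j :
  (w *m incidence r) i j = w i (r (sE j)) + w i (r (opp (sE j))).
Proof.
have pick d : \sum_k w i k * (r d == k)%:R = w i (r d).
  rewrite (bigD1 (r d)) //= eqxx mulr1 big1 ?addr0 // => k.
  by rewrite eq_sym => /negPf->; rewrite mulr0.
rewrite mxE -!pick -big_split /=; apply: eq_bigr => k _.
by rewrite mxE mulrDr.
Qed.

Lemma incidence_edge n (r : D -> 'I_n) i d :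
  incidence r i (rE d) = (r d == i)%:R + (r (opp d) == i)%:R.
Proof.
rewrite mxE; case: (dart_cases d) => [<- //|dE].
have -> : sE (rE d) = opp d by rewrite [in RHS]dE oppK.
by rewrite oppK addrC.
Qed.

Lemma mul_tr_incidence n (r : D -> 'I_n) m (h : 'M_(m, _)) i k :
  (h *m (incidence r)^T) i k = \sum_(d | r d == k) h i (rE d).
Proof.
rewrite [RHS]big_mkcond sum_edge_darts mxE; apply: eq_bigr => j _.
rewrite !mxE rE_opp sEK mulrDr; congr (_ + _);
  by case: ifP => _; rewrite ?mulr1 ?mulr0.
Qed.

(** On a connected map the only functions on the orbits of [f] that agree on
    both ends of each edge are the constants. *)
Lemma rank_incidence (d0 : D) (f : D -> D) (r : D -> 'I_(fcard f D)) s :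
  cancel s r -> (forall d e, (r d == r e) = fconnect f d e) ->
  (forall d e, connect [rel x y | (y == opp x) || (y == f x)] d e) ->
  (\rank (incidence r)).+1 = fcard f D.
Proof.
move=> sK rP conn; set A := incidence r.
have rf d : r (f d) = r d by apply/eqP; rewrite eq_sym rP fconnect1.
pose c : 'rV['F_2]_(fcard f D) := const_mx 1.
have kerA : (kermx A :=: c)%MS.
  apply/eqmxP/andP; split; last first.
    apply/sub_kermxP/matrixP => i j; rewrite mul_incidence !mxE.
    by apply: F2_addxx.
  apply/row_subP => i; set w := row i _.
  have wA : w *m A = 0 by apply/sub_kermxP; apply: row_sub.
  have w_opp d : w 0 (r (opp d)) = w 0 (r d).
    have eqE j : w 0 (r (opp (sE j))) = w 0 (r (sE j)).
      have := mul_incidence r w 0 j; rewrite wA mxE => /esym/eqP.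
      by rewrite addr_eq0 oppr_pchar2 ?pchar_Fp // => /eqP->.
    by case: (dart_cases d) => ->; rewrite ?oppK eqE.
  have w_const d e : w 0 (r d) = w 0 (r e).
    have /connectP[p + ->] := conn d e.
    elim: p d => //= x p IHp d /andP[/orP[]/eqP-> /IHp <-].
      by rewrite w_opp.
    by rewrite rf.
  suff -> : w = w 0 (r d0) *: c by apply: scalemx_sub.
  by apply/rowP => j; rewrite scalemx_const [RHS]mxE mulr1 -(sK j) (w_const (s j) d0).
have := mxrank_ker A; rewrite kerA rank_rV.
have -> : c != 0.
  by apply/eqP => /rowP/(_ (r d0)); rewrite !mxE => /eqP; rewrite oner_eq0.
have := ltn_ord (r d0); have := rank_leq_row A; lia.
Qed.

Variables (turn : D -> D).
Hypothesis turn_inj : injective turn.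
Let next d := turn (opp d).

Lemma next_inj : injective next.
Proof. by move=> d e /turn_inj /(can_inj oppK). Qed.

(** The incidence matrices of vertices against edges and of faces against edges
    form a complex; exactness at the edges equates the rank of the one, V - 1,
    with the corank of the other, E - (F - 1). *)
Lemma euler_of_exact (d0 : D) :
  (forall d e, connect [rel x y | (y == opp x) || (y == turn x)] d e) ->
  (forall h : D -> 'F_2, (forall d, h (opp d) = h d) ->
     (forall d, \sum_(e | fconnect next d e) h e = 0) ->
     exists u : D -> 'F_2,
       forall d, u (opp d) = u d + h d /\ u (next d) = u d + h d) ->
  (fcard turn D + fcard next D = fcard opp D + 2)%N.
Proof.
move=> conn exact.
have [rV [sV [sVK rVP]]] := orbit_index turn_inj.
have [rF [sF [sFK rFP]]] := orbit_index next_inj.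
have conn' d e : connect [rel x y | (y == opp x) || (y == next x)] d e.
  apply: connect_sub (conn d e) => x y /= /orP[]/eqP->.
    by apply: connect1; rewrite /= eqxx.
  apply: (@connect_trans _ _ (opp x)); apply: connect1; rewrite /= ?eqxx //.
  by rewrite /next oppK eqxx orbT.
have rankV := rank_incidence d0 sVK rVP conn.
have rankF := rank_incidence d0 sFK rFP conn'.
set B := incidence rV in rankV; set A := incidence rF in rankF.
have rV_next d : rV (opp d) = rV (next d).
  by apply/eqP; rewrite rVP fconnect1.
have rF_next d : rF (next d) = rF d.
  by apply/eqP; rewrite eq_sym rFP fconnect1.
have complex : B *m A^T = 0.
  apply/matrixP => i k; rewrite mul_tr_incidence mxE.
  under eq_bigr do rewrite incidence_edge rV_next.
  rewrite big_split /= [X in X + _](reindex_inj next_inj) /=.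
  under eq_bigl do rewrite rF_next.
  exact: F2_addxx.
have ranks : \rank B = \rank (kermx A^T).
  apply/eqmx_rank/andP; split; first exact/sub_kermxP.
  apply/row_subP => i; set h := row i _.
  have hA : h *m A^T = 0 by apply/sub_kermxP; apply: row_sub.
  have [|d|u uP] := exact (fun d => h 0 (rE d)).
  - by move=> d; rewrite rE_opp.
  - have := mul_tr_incidence rF h 0 (rF d); rewrite hA mxE => hd.
    by rewrite [RHS]hd; apply: eq_bigl => e; rewrite eq_sym rFP.
  have u_turn d : u (turn d) = u d.
    have [_] := uP (opp d); rewrite /next oppK rE_opp => ->.
    have [-> _] := uP d; by rewrite -addrA F2_addxx addr0.
  have u_sV d : u (sV (rV d)) = u d.
    have: fconnect turn d (sV (rV d)) by rewrite -rVP sVK.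
    by move=> /(fconnect_invariant (k := u)) -> // e; apply/eqP; rewrite u_turn.
  apply/submxP; exists (\row_i u (sV i)); apply/rowP => j.
  rewrite mul_incidence [X in _ = X + _]mxE [X in _ = _ + X]mxE !u_sV.
  by have [-> _] := uP (sE j); rewrite addrA F2_addxx add0r sEK.
have := rank_leq_col A; have := mxrank_ker A^T; rewrite -ranks mxrank_tr; lia.
Qed.

End Euler.

(** * Return times along an orbit *)

Section Gap.

Variables (D : finType) (f : D -> D) (p : pred D).
Hypothesis finj : injective f.

(** The number of steps that [f] takes from [d] to return to [p].  The expression
    is that of [edge_length], with [p] the set of darts that are not erased. *)
Definition gap d : nat := (find p (orbit f (f d))).+1.

Lemma gapP d e : fconnect f d e -> p e ->
  [/\ p (iter (gap d) f d), forall j, 0 < j < gap d -> ~~ p (iter j f d)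
    & gap d <= order f d].
Proof.
move=> de pe.
have ordE : order f (f d) = order f d.
  by apply: (eq_order_cycle (cycle_orbit finj d)); rewrite -fconnect_orbit ?fconnect1.
have orbE i : i < order f d -> nth (f d) (orbit f (f d)) i = iter i.+1 f d.
  by move=> i_lt; rewrite /orbit nth_traject ?ordE // iterSr.
have hasp : has p (orbit f (f d)).
  by apply/hasP; exists e; rewrite // -fconnect_orbit -same_fconnect1.
have gap_le : gap d <= order f d by rewrite -ordE -(size_orbit f) -has_find.
split=> //; first by rewrite -orbE // nth_find.
case=> // j /andP[_ j_lt]; rewrite -orbE; last exact: ltnW (leq_trans j_lt gap_le).
by rewrite before_find.
Qed.

Lemma gap_eq d m : 0 < m -> p (iter m f d) ->
  (forall j, 0 < j < m -> ~~ p (iter j f d)) -> gap d = m.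
Proof.
move=> m0 pm before; have [pg beforeg _] := gapP (fconnect_iter f m d) pm.
case: (ltngtP (gap d) m) => // lt.
  by have := before (gap d); rewrite lt pg => /(_ isT).
by have := beforeg m; rewrite m0 lt pm => /(_ isT).
Qed.

(** Kac's formula: the return times to a set along a cyclic orbit add up to the
    length of the orbit. *)
Lemma sum_gap r : p r -> \sum_(d | fconnect f r d && p d) gap d = order f r.
Proof.
move=> pr; set N := order f r.
(* From a return of p on, the return times up to the end of the orbit telescope. *)
have tail k i : N - i <= k -> i <= N -> p (iter i f r) ->
    \sum_(i <= j < N | p (iter j f r)) gap (iter j f r) = N - i.
  elim: k i => [|k IHk] i.
    by rewrite leqn0 => /eqP Ni _ _; rewrite Ni big_geq // -subn_eq0 Ni.
  case: (ltngtP i N) => // [iN Nk _ pi|->]; last by rewrite subnn big_geq.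
  have pN : p (iter (N - i) f (iter i f r)).
    by rewrite -iterD subnK ?(ltnW iN) // iter_order.
  have [pg beforeg _] := gapP (fconnect_iter f _ _) pN.
  set m := gap _ in pg beforeg.
  have mN : i + m <= N.
    rewrite leqNgt; apply/negP => lt; have := beforeg (N - i).
    by rewrite pN subn_gt0 iN ltn_subLR ?(ltnW iN) // => /(_ lt).
  rewrite (@big_cat_nat _ _ _ (i + m)) ?leq_addr //= IHk; last first.
  - by rewrite addnC iterD.
  - exact: mN.
  - by move: Nk mN; rewrite /m /gap; lia.
  rewrite big_ltn_cond ?pi; last by rewrite -[ltnLHS]addn0 ltn_add2l.
  rewrite big_nat_cond big1 => [|j /andP[/andP[ij jm]]]; first by rewrite -/m; lia.
  have := beforeg (j - i); rewrite -iterD subnK ?(ltnW ij) // => /(_ _)/negPf->//.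
  by rewrite subn_gt0 ij ltn_subLR ?(ltnW ij).
have := tail N 0 (leq_subr _ _) (leq0n _) pr; rewrite subn0 => <-.
rewrite big_mkcondr /= (eq_bigl (mem (orbit f r))) => [|d]; last exact: fconnect_orbit.
rewrite -big_uniq ?orbit_uniq //= (big_nth r) size_orbit [RHS]big_mkcond /=.
by apply: eq_big_nat => j /andP[_ jN]; rewrite /orbit nth_traject.
Qed.

End Gap.

(** * Merged edges of a diagram *)

Lemma nth_inv_word X (x0 : letter X) w i : i < size w ->
  nth x0 (inv_word w) i = inv_letter (nth x0 w (size w - i.+1)).
Proof.
move=> iw; rewrite /inv_word nth_rev ?size_map // (nth_map x0) //.
by rewrite ltn_subrL /= (leq_trans _ iw).
Qed.

Section Diagram.

Variables (X : Type) (R : word X -> Prop) (M : diagram R).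
Implicit Types d e z : M.

Local Notation turn := (@turn M).
Local Notation opp := (@opp M).
Local Notation next := (@face_next M).
Local Notation prev := (finv next).
Local Notation len := (@edge_length _ _ M).
Local Notation kept := (predC (@erased _ _ M)).
Local Notation rlen := (@relator_length _ _ M).

Lemma face_next_inj : injective next.
Proof. by move=> d e /turn_inj /(can_inj (@oppK M)). Qed.

Lemma next_opp d : next (opp d) = turn d.
Proof. by rewrite /face_next oppK. Qed.

Lemma opp_prev d : opp (prev d) = finv turn d.
Proof.
apply: (@turn_inj M); rewrite (f_finv (@turn_inj M)).
exact: (f_finv face_next_inj).
Qed.

Lemma removed_opp_turn d : removed (turn d) = removed (opp d).
Proof. by rewrite -next_opp removed_face. Qed.

Lemma removed_connect d e : fconnect next d e -> removed d = removed e.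
Proof.
move=> de; apply: (fconnect_invariant (k := fun x => removed x) _ de) => x.
by apply/eqP; rewrite removed_face.
Qed.

Lemma removed_noninterior d : removed d -> ~~ interior d.
Proof.
by move=> rd; apply/forallP => /(_ d); rewrite connect0 rd.
Qed.

Lemma interior_turn d : interior (turn d) = interior d.
Proof.
apply: eq_forallb => x.
by rewrite -same_fconnect1 //; apply: turn_inj.
Qed.

Lemma erased_turn d : erased (turn d) = erased d.
Proof.
rewrite /erased interior_turn /degree; congr (_ && (_ == _)).
by apply: (eq_order_cycle (cycle_orbit (@turn_inj M) d));
  rewrite -fconnect_orbit ?fconnect1.
Qed.

Lemma erased_turn2 d : erased d -> turn (turn d) = d.
Proof.
case/andP=> _ /eqP d2.
by have := iter_order (@turn_inj M) d; rewrite [order _ _]d2.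
Qed.

Lemma erased_removed d : removed d -> erased d = false.
Proof. by move/removed_noninterior/negPf; rewrite /erased => ->. Qed.

Lemma len_gap d : len d = gap next kept d.
Proof. by []. Qed.

(** The ends of a boundary edge are not interior, so that nothing is merged. *)
Lemma len_boundary d : removed d || removed (opp d) -> len d = 1.
Proof.
move=> rd; rewrite len_gap; apply: gap_eq; rewrite ?face_next_inj //=.
- exact: face_next_inj.
- case/orP: rd => rd; first by rewrite erased_removed ?removed_face.
  by rewrite /face_next erased_turn erased_removed.
- by move=> [|[]].
Qed.

(** While it only passes erased vertices, a walk along one side of an edge
    stays opposite to the walk along the other side. *)
Lemma iter_next_opp z j : (forall i, 0 < i <= j -> erased (iter i next (opp z))) ->
  iter j next (opp z) = opp (iter j prev z).
Proof.
elim: j => //= j IHj er.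
have yE : iter j next (opp z) = opp (iter j prev z).
  by apply: IHj => i /andP[i0 ij]; apply: er; rewrite i0 leqW.
have := er j.+1; rewrite ltnSn /= yE next_opp => /(_ isT).
rewrite erased_turn => /erased_turn2 w2.
apply: (can_inj (@oppK M)); rewrite oppK; apply: face_next_inj.
by rewrite (f_finv face_next_inj) next_opp.
Qed.

Section HasBoundary.

Variable d0 : M.
Hypothesis removed0 : removed d0.

(** If all vertices of a face were erased then the diagram would consist of
    that face and one other, and nothing would have been removed. *)
Lemma face_not_erased d : exists2 e, fconnect next d e & ~~ erased e.
Proof.
apply: contrapT => no.
have fe e : fconnect next d e -> erased e.
  by move=> de; apply/negPn/negP => ?; apply: no; exists e.
have fo e : fconnect next d (opp e) -> erased e.
  rewrite same_fconnect1_r ?next_opp; last exact: face_next_inj.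
  by move/fe; rewrite erased_turn.
pose C e := fconnect next d e || fconnect next d (opp e).
have C_turn e : C e -> C (turn e).
  rewrite /C => /orP[de|de].
    rewrite orbC same_fconnect1_r ?next_opp; last exact: face_next_inj.
    by rewrite erased_turn2 ?de //; apply: fe.
  by rewrite -next_opp -same_fconnect1_r ?de //; apply: face_next_inj.
have C_all : C d0.
  have /connectP[p ep ->] := sphere_connected d d0.
  suff walk c : C c ->
      path [rel x y | (y == opp x) || (y == turn x)] c p -> C (last c p).
    by apply: walk ep; rewrite /C connect0.
  elim: p c {ep} => [|x p IHp] c //= Cc /andP[cx xp]; apply: IHp xp.
  by case/orP: cx => /eqP->; [rewrite /C oppK orbC | apply: C_turn].
have : erased d0 by case/orP: C_all => [/fe|/fo].
by rewrite erased_removed.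
Qed.

(** The edge that ends at the initial vertex of [d] on the face of [d] is merged
    with as many edges as one passes walking backwards around this face. *)
Lemma prev_len d : ~~ erased d ->
  len (finv turn d) = gap prev kept d.
Proof.
move=> nd; rewrite -opp_prev; set z := prev d; apply/esym.
have [e ze ne] := face_not_erased (opp z).
have [] := gapP (p := kept) face_next_inj ze ne.
rewrite -len_gap; have : 0 < len (opp z) by [].
move: (len (opp z)) => m m0 pm before _.
have er i : 0 < i <= m -> iter i next (opp z) = turn (iter i prev d).
  case: i => // i /andP[_ im]; rewrite [LHS]iterS iter_next_opp.
    by rewrite next_opp iterSr.
  by move=> j /andP[j0 ji]; apply/negPn; apply: before; rewrite j0 (leq_ltn_trans ji).
apply: gap_eq => //.
- by apply: finv_inj; apply: face_next_inj.
- by move: pm; rewrite /= er ?m0 ?leqnn // erased_turn.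
move=> j /andP[j0 jm]; have := before j; rewrite /= er ?j0 ?(ltnW jm) // erased_turn.
exact.
Qed.

Lemma sum_len_face d :
  \sum_(e | fconnect next d e && ~~ erased e) len e = order next d /\
  \sum_(e | fconnect next d e && ~~ erased e) len (finv turn e) = order next d.
Proof.
have [e de ne] := face_not_erased d.
have conn : fconnect next d =1 fconnect next e.
  exact: (same_connect (fconnect_sym face_next_inj) de).
have ord : order next d = order next e by apply: eq_card.
split.
  rewrite ord -(sum_gap (p := predC (@erased _ _ M)) face_next_inj (r := e)) //.
  by apply: eq_bigl => x; rewrite conn.
have pinj := finv_inj face_next_inj.
rewrite ord -(order_finv face_next_inj).
rewrite -(sum_gap (p := predC (@erased _ _ M)) pinj (r := e)) //.
apply: eq_big => [x|x /andP[_ nx]]; last exact: prev_len.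
by rewrite conn same_fconnect_finv //; apply: face_next_inj.
Qed.

Lemma len_le_order d : len d <= order next d.
Proof.
have [e de ne] := face_not_erased d.
by have [] := gapP (p := kept) face_next_inj de ne.
Qed.

Lemma order_next d : order next (next d) = order next d.
Proof.
by apply: (eq_order_cycle (cycle_orbit face_next_inj d));
  rewrite -fconnect_orbit ?fconnect1.
Qed.

Lemma len_le_order_opp d : ~~ erased d -> len d <= order next (opp d).
Proof.
move=> nd; have ntd : ~~ erased (turn d) by rewrite erased_turn.
have := prev_len ntd; rewrite (finv_f (@turn_inj M)) => ->.
have pinj := finv_inj face_next_inj.
rewrite -order_next next_opp -(order_finv face_next_inj).
have [e de ne] := face_not_erased (turn d).
have de' : fconnect prev (turn d) e by rewrite same_fconnect_finv //; apply: face_next_inj.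
by have [] := gapP (p := kept) pinj de' ne.
Qed.

Lemma size_face_label d : size (face_label d) = order next d.
Proof. by rewrite size_map size_orbit. Qed.

Lemma nth_face_label a0 d i : i < order next d ->
  nth a0 (face_label d) i = lab (iter i next d).
Proof.
by move=> id; rewrite (nth_map d) ?size_orbit // /orbit nth_traject.
Qed.

(** Reading the face across [d] against its orientation, with [d] first, visits
    the darts opposite to those of a backward walk from [opp d]. *)
Lemma nth_opp_label a0 d i : i < order next (opp d) ->
  nth a0 (inv_word (face_label (next (opp d)))) i = lab (opp (iter i prev (opp d))).
Proof.
move=> id; rewrite nth_inv_word ?size_face_label ?order_next //.
rewrite nth_face_label ?order_next; last by rewrite ltn_subrL /= (leq_trans _ id).
by rewrite lab_opp -iterSr -subSn // subSS iter_finv ?(ltnW id) //; apply: face_next_inj.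
Qed.

Hypothesis R_reduced : forall r, Rstar R r -> freely_reduced r.
Hypothesis M_reduced : reduced M.

Lemma iterK (T : Type) (f g : T -> T) n : cancel f g -> cancel (iter n f) (iter n g).
Proof. by move=> fK; elim: n => // n IHn x; rewrite iterSr iterS fK IHn. Qed.

(** On different faces this is what reduced means.  If [d] and [opp d] lie on the
    same face, equality would make the relator of that face a cyclic permutation
    of its inverse; the reflection then fixes a letter, or exchanges two
    consecutive letters, on the arc from [d] to [opp d]. *)
Lemma opp_label_neq d : ~~ removed d -> ~~ removed (opp d) ->
  face_label d <> inv_word (face_label (next (opp d))).
Proof.
move=> rd rod lE; case: (boolP (fconnect next d (opp d))) => [dd|ndd]; last first.
  by apply: M_reduced; exists d.
pose a0 := lab d.
have j_max := findex_max dd; have j_it := iter_findex dd.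
set j := findex _ _ _ in j_max j_it.
have ordE : order next (opp d) = order next d.
  by apply: eq_card => x; apply/esym/(same_connect (fconnect_sym face_next_inj)).
have refl i : i <= j -> lab (iter i next d) = inv_letter (lab (iter (j - i) next d)).
  move=> ij; have id := leq_ltn_trans ij j_max.
  rewrite -(nth_face_label a0) // lE nth_opp_label ?ordE // -j_it.
  by rewrite -{1}(subnKC ij) iterD iterK ?lab_opp //; apply/finv_f/face_next_inj.
have jE := odd_double_half j; set i := j./2 in jE.
have := refl i; case: (odd j) jE => jE; rewrite -jE -addnn; last first.
  by rewrite add0n leq_addr addnK => /(_ isT) /esym; apply: inv_letter_neq.
have -> : true + (i + i) - i = i.+1 by lia.
move=> /(_ _) lab_i; have {}lab_i := lab_i (leq_trans (leq_addr _ _) (leq_addl _ _)).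
have i1 : i.+1 < order next d by apply: leq_ltn_trans j_max; rewrite -jE; lia.
have i0 := ltnW i1.
have := R_reduced (lab_face rd).
move=> /(_ (take i (face_label d)) (drop i.+2 (face_label d)) (lab (iter i next d))).
apply; rewrite -[LHS](cat_take_drop i); congr (_ ++ _).
rewrite (drop_nth a0) ?size_face_label // (drop_nth a0) ?size_face_label //.
by rewrite !nth_face_label // lab_i inv_letterK.
Qed.

Hypothesis R_half : small_cancellation R (1 / 2)%R.

(** A merged edge with the diagram on both sides is labelled by a piece. *)
Lemma len_half d : ~~ erased d -> ~~ removed d -> ~~ removed (opp d) ->
  2 * len d < rlen d /\ 2 * len d < rlen (opp d).
Proof.
move=> nd rd rod; pose a0 := lab d; set m := len d.
have neq := opp_label_neq rd rod.
set r := face_label d in neq; set r' := inv_word _ in neq.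
have rR : Rstar R r by apply: lab_face.
have rR' : Rstar R r' by apply/Rstar_inv/lab_face; rewrite removed_face.
have szr : size r = order next d by rewrite size_face_label.
have szr' : size r' = order next (opp d).
  by rewrite size_inv_word size_face_label order_next.
have mr : m <= order next d by apply: len_le_order.
have mr' : m <= order next (opp d) by apply: len_le_order_opp.
have tt' : take m r = take m r'.
  apply: (@eq_from_nth _ a0) => [|i]; rewrite !size_takel ?szr ?szr' // => im.
  rewrite !nth_take // nth_face_label ?(leq_trans im) //.
  rewrite nth_opp_label ?(leq_trans im) // -iter_next_opp ?oppK // => k /andP[k0 ki].
  have [e de ne] := face_not_erased d.
  have [_ + _] := gapP (p := kept) face_next_inj de ne.
  by move=> /(_ k); rewrite k0 -len_gap (leq_ltn_trans ki im) => /(_ isT) /negPn.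
have pre : prefix_of (take m r) r by exists (drop m r); rewrite cat_take_drop.
have pre' : prefix_of (take m r) r'.
  by rewrite tt'; exists (drop m r'); rewrite cat_take_drop.
have pc : piece R (take m r) by exists r, r'.
have := R_half pc rR pre; have := R_half pc rR' pre'.
rewrite size_takel ?szr // szr' /relator_length !size_face_label.
by split; rewrite -(@ltr_nat rat); lra.
Qed.

(** * The curvature of a disk diagram *)

Local Open Scope ring_scope.

Variable n : nat.
Hypotheses (n_ge2 : (2 <= n)%N) (rlen_ge : forall d, ~~ removed d -> (n <= rlen d)%N).

(** The angle, in units of pi, of the corner that precedes [d] on its face.  The
    corners of a face that lies in the diagram add up as in a Euclidean polygon,
    and condition tau' says that interior vertices have nonpositive curvature. *)
Definition angle d : rat :=
  if removed d || erased d then 1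
  else 1 - (len (finv turn d) + len d)%:R / (rlen d)%:R.

Lemma n_gt0 : (0 < n%:R :> rat).
Proof. by rewrite ltr0n (leq_trans _ n_ge2). Qed.

Lemma inv_n_half : n%:R^-1 <= 1 / 2 :> rat.
Proof.
by rewrite mul1r lef_pV2 ?posrE ?n_gt0 ?ltr0n // ler_nat.
Qed.

Lemma inv_rlen d : ~~ removed d -> 0 < ((rlen d)%:R^-1 : rat) <= n%:R^-1.
Proof.
move=> rd; have r0 : 0 < (rlen d)%:R :> rat.
  by apply: lt_le_trans n_gt0 _; rewrite ler_nat rlen_ge.
by rewrite invr_gt0 r0 lef_pV2 ?posrE ?n_gt0 // ler_nat rlen_ge.
Qed.

Lemma rlen_next d : rlen (next d) = rlen d.
Proof. by rewrite /relator_length !size_face_label order_next. Qed.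

Lemma len_le_half d : ~~ erased d ->
  (~~ removed d -> (2 * len d <= rlen d)%N) /\
  (~~ removed (opp d) -> (2 * len d <= rlen (opp d))%N).
Proof.
move=> nd; case: (boolP (removed d || removed (opp d))) => [rd|].
  rewrite (len_boundary rd) muln1.
  by split=> ?; apply: leq_trans n_ge2 _; apply: rlen_ge.
by rewrite negb_or => /andP[rd rod]; have [/ltnW ? /ltnW ?] := len_half nd rd rod.
Qed.

(** Both edges at a corner are at most half as long as the relator: merged edges
    because they are pieces, boundary edges because they have length 1. *)
Lemma corner_half d : ~~ erased d -> ~~ removed d ->
  (len d)%:R / (rlen d)%:R <= 1 / 2 :> rat /\
  (len (finv turn d))%:R / (rlen d)%:R <= 1 / 2 :> rat.
Proof.
move=> nd rd; have /andP[r0 _] := inv_rlen rd.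
have dE : next (prev d) = d by apply: f_finv; apply: face_next_inj.
have half (l : nat) : (2 * l <= rlen d)%N -> l%:R / (rlen d)%:R <= 1 / 2 :> rat.
  rewrite -(ler_nat rat) natrM => h.
  move: r0; rewrite invr_gt0 => r0.
  by rewrite ler_pdivrMr // mul1r mulrC ler_pdivlMr ?ltr0n // mulrC.
have [h _] := len_le_half nd; split; apply: half; first exact: h.
have nfd : ~~ erased (finv turn d).
  by rewrite -erased_turn f_finv //; apply: turn_inj.
have [_] := len_le_half nfd.
have rE : rlen (prev d) = rlen d by rewrite -[in RHS]dE rlen_next.
rewrite -opp_prev oppK rE; apply.
by rewrite -removed_face dE.
Qed.

Lemma angle_ge0 d : 0 <= angle d.
Proof.
rewrite /angle; case: ifP => // /negbT; rewrite negb_or => /andP[rd nd].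
have [] := corner_half nd rd; rewrite natrD mulrDl; lra.
Qed.

(** For a corner next to a boundary edge. *)
Lemma angle_one_side d : ~~ erased d -> ~~ removed d ->
  len d = 1%N \/ len (finv turn d) = 1%N -> 1 / 2 - n%:R^-1 <= angle d.
Proof.
move=> nd rd one; rewrite /angle (negPf nd) (negPf rd) /=.
have [] := corner_half nd rd; have /andP[_] := inv_rlen rd.
by rewrite natrD mulrDl; case: one => ->; rewrite mul1r; lra.
Qed.

Lemma angle_two_sides d : ~~ erased d -> ~~ removed d ->
  len d = 1%N -> len (finv turn d) = 1%N -> 1 - 2 * n%:R^-1 <= angle d.
Proof.
move=> nd rd l1 l1'; rewrite /angle (negPf nd) (negPf rd) /= l1 l1'.
by have /andP[_] := inv_rlen rd; rewrite natrD mulrDl mul1r; lra.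
Qed.

Lemma sum_orbits (f : M -> M) (g : M -> rat) : injective f ->
  \sum_d g d = \sum_(r | froots f r) \sum_(d | fconnect f r d) g d.
Proof.
move=> finj; have fsym := fconnect_sym finj.
rewrite (partition_big (froot f) (froots f)) => [|d _]; last exact: roots_root.
apply: eq_bigr => r /eqP rr; apply: eq_bigl => d /=.
by rewrite -{1}rr eq_sym (root_connect fsym).
Qed.

Lemma sum_const_orbit (f : M -> M) d : \sum_(e | fconnect f d e) 1 = (order f d)%:R :> rat.
Proof. by rewrite sumr_const; congr (_ *+ _); apply: eq_card. Qed.

(** Each edge of a face is counted at the two corners that it joins, so that the
    angles of a face with [k] edges have sum [k - 2]; the removed faces have
    angles 1. *)
Lemma face_angle d :
  \sum_(e | fconnect next d e) angle e =
  \sum_(e | fconnect next d e) 1 - 2 + 2 * (removed d)%:R.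
Proof.
rewrite sum_const_orbit.
case: (boolP (removed d)) => rd.
  rewrite mulr1 subrK -sum_const_orbit; apply: eq_bigr => e de.
  by rewrite /angle -(removed_connect de) rd.
rewrite mulr0 addr0.
have rlenE e : fconnect next d e -> rlen e = order next d.
  move=> de; rewrite /relator_length size_face_label.
  by apply: eq_card => x; apply/esym/(same_connect (fconnect_sym face_next_inj)).
have angleE e : fconnect next d e -> angle e = 1 -
    (if ~~ erased e then (len (finv turn e) + len e)%:R else 0) / (order next d)%:R.
  move=> de; rewrite /angle -(removed_connect de) (negPf rd) rlenE //=.
  by case: (erased e); rewrite //= mul0r subr0.
rewrite (eq_bigr _ angleE) sumrB sum_const_orbit -mulr_suml -big_mkcondr /=.
rewrite -natr_sum big_split /=; have [-> ->] := sum_len_face d.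
have : (order next d)%:R != 0 :> rat by rewrite pnatr_eq0 -lt0n order_gt0.
by rewrite natrD => ?; congr (_ - _); field.
Qed.

Hypothesis M_tau : forall d, interior d -> (degree d != 2)%N ->
  dF' d <= (degree d)%:R - 2%:R.
Hypothesis no_spike : forall d, removed d -> turn d != d.

(** The curvature of a vertex is at most [2 / n] times the number of boundary
    corners at it.  At interior vertices this is condition tau' (erased vertices
    have two angles 1).  Two boundary corners already have angles of sum 2.  With
    one boundary corner, the corners next to it lie along boundary edges of
    length 1: if it is one corner, its angle is at least [1 - 2 / n]; otherwise
    both of them have an angle of at least [1 / 2 - 1 / n], as the other edge is
    at most half a relator long. *)
Lemma vertex_angle d :
  2 - 2 * n%:R^-1 * (\sum_(e | fconnect turn d e) (removed e)%:R) <=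
  \sum_(e | fconnect turn d e) angle e.
Proof.
have tsym := fconnect_sym (@turn_inj M).
have inv := inv_n_half; have inv0 : 0 < n%:R^-1 :> rat by rewrite invr_gt0 n_gt0.
have int_conn e : fconnect turn d e -> interior e = interior d.
  move=> de; apply/esym; apply: (fconnect_invariant (k := fun x => interior x) _ de) => x.
  by apply/eqP; rewrite interior_turn.
have er_conn e : fconnect turn d e -> erased e = erased d.
  move=> de; apply/esym; apply: (fconnect_invariant (k := fun x => erased x) _ de) => x.
  by apply/eqP; rewrite erased_turn.
case: (boolP (interior d)) => [int|/forallPn[y0]].
  have nr e : fconnect turn d e -> removed e = false.
    by move=> de; apply/negbTE; move/forallP/(_ e): int; rewrite de.
  rewrite big1 => [|e /nr->//]; rewrite mulr0 subr0.
  case: (boolP (degree d == 2)%N) => [/eqP d2|d2].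
    rewrite (eq_bigr (fun _ => 1)) => [|e de].
      by rewrite sum_const_orbit -[order _ _]/(degree d) d2.
    by rewrite /angle er_conn // /erased int d2 orbT.
  have := M_tau int d2; rewrite /dF' big_uniq ?orbit_uniq //=.
  rewrite (eq_bigl (fconnect turn d)) => [|e]; last by rewrite -fconnect_orbit.
  have angleE e : fconnect turn d e ->
      angle e = 1 - (len (finv turn e) + len e)%:R / (rlen e)%:R.
    by move=> de; rewrite /angle nr // er_conn // /erased int (negPf d2).
  rewrite [X in _ -> _ <= X](eq_bigr _ angleE) sumrB sum_const_orbit.
  rewrite -[order _ _]/(degree d).
  rewrite [X in _ -> _ <= _ - X](reindex_inj (@turn_inj M)) /=.
  under [X in _ -> _ <= _ - X]eq_bigl => e do rewrite -(same_fconnect1_r (@turn_inj M)).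
  under [X in _ -> _ <= _ - X]eq_bigr => e do rewrite (finv_f (@turn_inj M)).
  lra.
rewrite negb_imply negbK => /andP[dy0 ry0].
have nint : interior d = false.
  by rewrite -(int_conn y0) // (negPf (removed_noninterior ry0)).
have ner e : fconnect turn d e -> ~~ erased e.
  by move=> de; rewrite /erased int_conn // nint.
have ang_y0 : angle y0 = 1 by rewrite /angle ry0.
rewrite (bigD1 y0) //= ry0 [X in _ <= X](bigD1 y0) //= ang_y0.
case: (boolP [exists y1, [&& fconnect turn d y1, y1 != y0 & removed y1]]).
  case/existsP=> y1 /and3P[dy1 y10 ry1].
  have ang_y1 : angle y1 = 1 by rewrite /angle ry1.
  rewrite [X in _ <= _ + X](bigD1 y1) ?dy1 //= ang_y1.
  set s := \sum_(i | _) _; have s0 : 0 <= s by apply: sumr_ge0 => *; apply: ler0n.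
  set t := \sum_(i | _) _; have t0 : 0 <= t by apply: sumr_ge0 => *; apply: angle_ge0.
  nra.
rewrite negb_exists => /forallP no.
have nr e : fconnect turn d e -> e != y0 -> removed e = false.
  by move=> de ey; have := no e; rewrite de ey /= => /negbTE.
rewrite [X in _ * (_ + X)]big1 => [|e /andP[de ey]]; last by rewrite nr.
set x0 := finv turn y0; set y1 := turn y0.
have tx0 : turn x0 = y0 by apply: f_finv; apply: turn_inj.
have dx0 : fconnect turn d x0.
  by apply: connect_trans dy0 _; rewrite /x0 fconnect_finv.
have dy1 : fconnect turn d y1 by apply: connect_trans dy0 (fconnect1 _ _).
have x0y0 : x0 != y0 by apply: contra (no_spike ry0) => /eqP xy; rewrite -{1}xy tx0.
have y1y0 : y1 != y0 by apply: no_spike.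
have lx0 : len x0 = 1%N.
  by rewrite len_boundary // -removed_opp_turn tx0 ry0 orbT.
have ly0 : len y0 = 1%N by rewrite len_boundary ?ry0.
have rx0 : ~~ removed x0 by rewrite nr.
rewrite addr0 (bigD1 x0) ?dx0 //=.
case: (eqVneq y1 x0) => [yx|yx].
  have a := angle_two_sides (ner _ dx0) rx0 lx0.
  have {}a : 1 - 2 / n%:R <= angle x0.
    by apply: a; rewrite -yx /y1 finv_f //; apply: turn_inj.
  set t := \sum_(i | _) _; have t0 : 0 <= t by apply: sumr_ge0 => *; apply: angle_ge0.
  lra.
have ax0 := angle_one_side (ner _ dx0) rx0 (or_introl lx0).
have ry1 : ~~ removed y1 by rewrite nr.
have ay1 : 1 / 2 - n%:R^-1 <= angle y1.
  apply: angle_one_side => //; first exact: ner.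
  by right; rewrite /y1 finv_f //; apply: turn_inj.
rewrite (bigD1 y1) ?dy1 ?y1y0 ?yx //=.
set t := \sum_(i | _) _; have t0 : 0 <= t by apply: sumr_ge0 => *; apply: angle_ge0.
lra.
Qed.

Hypothesis outer_face : forall d, removed d = fconnect next d0 d.

(** Gauss--Bonnet: since the angles of the removed face sum up to 2 more than
    those of a Euclidean polygon, the total curvature is 2, and each boundary
    corner accounts for at most [2 / n]. *)
Lemma boundary_length : (n <= order next d0)%N.
Proof.
have nsym := fconnect_sym face_next_inj.
have sum_roots (f : M -> M) (c : rat) : \sum_(r | froots f r) c = c * (fcard f M)%:R.
  rewrite sumr_const -[LHS]mulr_natr; congr (_ * _%:R).
  by apply: eq_card => r; rewrite !inE /= andbT.
have one_face : \sum_(r | froots next r) (removed r)%:R = 1 :> rat.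
  rewrite (bigD1 (froot next d0)) /=; last exact: roots_root.
  rewrite outer_face connect_root big1 ?addr0 // => r /andP[/eqP rr].
  by rewrite outer_face -(root_connect nsym) rr eq_sym => /negPf->.
have total_f : \sum_d angle d = #|M|%:R - 2 * (fcard next M)%:R + 2.
  rewrite (sum_orbits _ face_next_inj) (eq_bigr _ (fun d _ => face_angle d)).
  rewrite !big_split /= -mulr_sumr one_face mulr1 -sum_orbits; last exact: face_next_inj.
  by rewrite sum_roots mulNr sumr_const.
have total_v : 2 * (fcard turn M)%:R - 2 * n%:R^-1 * (order next d0)%:R <= \sum_d angle d.
  rewrite (sum_orbits _ (@turn_inj M)).
  apply: le_trans; last by apply: ler_sum => d _; apply: vertex_angle.
  rewrite sumrB sum_roots -mulr_sumr -sum_orbits; last exact: turn_inj.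
  rewrite (eq_bigr (fun d => if fconnect next d0 d then 1 else 0)) => [|d _].
    by rewrite -big_mkcond sum_const_orbit.
  by rewrite outer_face; case: ifP.
have edges : (fcard opp M * 2 = #|M|)%N.
  apply: fcard_order_set; first exact: (can_inj (@oppK M)); last by move=> ? ?.
  apply/subsetP => d _; rewrite inE /order.
  rewrite (eq_card (B := pred2 d (opp d))) => [|e]; last exact: (fconnect_opp (@oppK M)).
  by rewrite card2 [d == _]eq_sym opp_neq.
have := sphere_euler M.
have -> : fcard (turn \o opp) M = fcard next M by apply: eq_fcard.
move/(congr1 (fun k => k%:R : rat)); rewrite !natrD => euler.
have n0 := n_gt0; rewrite -(ler_nat rat) -(ler_pM2l (x := n%:R^-1)) ?invr_gt0 //.
rewrite mulVf ?gt_eqF //.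
have edges' : 2 * (fcard opp M)%:R = #|M|%:R :> rat by rewrite -edges natrM mulrC.
lra.
Qed.

End HasBoundary.

End Diagram.

(** * Realising a sewn disk as a diagram *)

Lemma uniq_flatten_mem (T : eqType) (ll : seq (seq T)) l l' x : uniq (flatten ll) ->
  l \in ll -> l' \in ll -> x \in l -> x \in l' -> l = l'.
Proof.
elim: ll => //= k ll IH; rewrite cat_uniq => /and3P[_ /hasPn dis un].
rewrite !inE => /orP[/eqP->|lll] /orP[/eqP->|l'll] // xl xl'; last exact: IH.
  by have /negP[] := dis x (introT flattenP (ex_intro2 _ _ l' l'll xl')).
by have /negP[] := dis x (introT flattenP (ex_intro2 _ _ l lll xl)).
Qed.

Lemma orbit_next_rot (T : finType) (f : T -> T) x : injective f ->
  orbit f x = x :: behead (orbit f x) /\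
  orbit f (f x) = rcons (behead (orbit f x)) x.
Proof.
move=> finj; have := order_gt0 f x; have := iter_order finj x.
have ordE : order f (f x) = order f x.
  by apply: (eq_order_cycle (cycle_orbit finj x)); rewrite -fconnect_orbit ?fconnect1.
rewrite /orbit ordE; case: (order f x) => // k kx _; split=> //.
by rewrite trajectSr -iterSr kx.
Qed.

Section Realise.

Variables (X : Type) (R : word X -> Prop).
Variables (B : seq nat) (L : seq (seq nat)) (opp : nat -> nat).
Variables (lab : nat -> letter X).
Hypothesis DB : disk R B L opp lab.

Local Notation S := (B ++ flatten L).
Local Notation T := (seq_sub S).
Implicit Types (d : nat) (l : seq nat) (t : T).

Definition face_of d : seq nat := nth [::] (B :: L) (find (fun l => d \in l) (B :: L)).

Lemma face_of_mem d : d \in S -> face_of d \in B :: L /\ d \in face_of d.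
Proof.
move=> dS; have hasd : has (fun l => d \in l) (B :: L).
  move: dS; rewrite mem_cat /= => /orP[-> // | /flattenP[l lL dl]].
  by apply/orP; right; apply/hasP; exists l.
by split; [apply: mem_nth; rewrite -has_find | apply: (nth_find [::] hasd)].
Qed.

Lemma face_ofE d l : l \in B :: L -> d \in l -> face_of d = l.
Proof.
move=> lBL dl; have dS : d \in S.
  by have := introT flattenP (ex_intro2 _ _ l lBL dl).
have [fBL df] := face_of_mem dS.
by apply: uniq_flatten_mem fBL lBL df dl; apply: disk_uniq DB.
Qed.

Lemma face_sub d l : l \in B :: L -> d \in l -> d \in S.
Proof. by move=> lBL dl; have := introT flattenP (ex_intro2 _ _ l lBL dl). Qed.

Lemma outer_face_of d : d \in S -> (d \in B) = (face_of d == B).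
Proof.
move=> dS; apply/idP/eqP => [|fB]; first exact: face_ofE (mem_head _ _).
by have [_] := face_of_mem dS; rewrite fB.
Qed.

Definition sub_opp t : T := insubd t (opp (val t)).
Definition sub_next t : T := insubd t (next (face_of (val t)) (val t)).
Definition sub_turn t : T := sub_next (sub_opp t).

Lemma val_opp t : val (sub_opp t) = opp (val t).
Proof. by rewrite insubdK //; have [] := disk_opp DB (valP t). Qed.

Lemma val_next t : val (sub_next t) = next (face_of (val t)) (val t).
Proof.
have [fBL tf] := face_of_mem (valP t).
by rewrite insubdK //; apply: (face_sub fBL); rewrite mem_next.
Qed.

Lemma sub_oppK : involutive sub_opp.
Proof. by move=> t; apply: val_inj; rewrite !val_opp; have [] := disk_opp DB (valP t). Qed.

Lemma sub_opp_neq t : sub_opp t != t.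
Proof.
apply/eqP => /(congr1 val); rewrite val_opp; by have [] := disk_opp DB (valP t).
Qed.

Lemma face_of_next t : face_of (val (sub_next t)) = face_of (val t).
Proof.
have [fBL tf] := face_of_mem (valP t).
by rewrite val_next; apply: face_ofE; rewrite // mem_next.
Qed.

Lemma face_uniq l : l \in B :: L -> uniq l.
Proof.
move=> lBL; have := disk_uniq DB; rewrite -[S]/(flatten (B :: L)).
elim: (B :: L) lBL => //= k ll IH.
rewrite inE cat_uniq => /orP[/eqP->|/IH ul] /and3P[] // _ _ /ul.
Qed.

Lemma sub_next_inj : injective sub_next.
Proof.
move=> t t' tt'; have ff : face_of (val t) = face_of (val t').
  by rewrite -face_of_next tt' face_of_next.
apply: val_inj; move/(congr1 val): tt'; rewrite !val_next ff.
have [fBL _] := face_of_mem (valP t').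
exact: (can_inj (prev_next (face_uniq fBL))).
Qed.

Lemma sub_turn_inj : injective sub_turn.
Proof. by move=> t t' /sub_next_inj /(can_inj sub_oppK). Qed.

Lemma orbit_sub_next t : exists i, map val (orbit sub_next t) = rot i (face_of (val t)).
Proof.
have [fBL tf] := face_of_mem (valP t); set l := face_of _ in fBL tf *.
pose lT := map (insubd t) l.
have lTE : map val lT = l.
  rewrite -map_comp -[RHS]map_id; apply/eq_in_map => d dl /=.
  by rewrite insubdK //; apply: face_sub dl.
have ulT : uniq lT by rewrite -(map_inj_uniq val_inj) lTE face_uniq.
have tlT : t \in lT by rewrite -(mem_map val_inj) lTE.
have clT : fcycle sub_next lT.
  have eq_next : {in lT &, relpre val (frel (next l)) =2 frel sub_next}.
    move=> x y xlT _ /=; rewrite -(inj_eq val_inj) val_next; congr (next _ _ == _).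
    by apply/esym/face_ofE; rewrite // -lTE map_f.
  rewrite -(eq_in_cycle eq_next); last exact/allP.
  by rewrite -cycle_map lTE cycle_next ?face_uniq.
by exists (index t lT); rewrite (orbitE clT) // map_rot lTE.
Qed.

Lemma sub_fconnect t t' : fconnect sub_next t t' = (val t' \in face_of (val t)).
Proof.
have [i iE] := orbit_sub_next t.
by rewrite fconnect_orbit -(mem_map val_inj) iE mem_rot.
Qed.

Lemma sub_exact (h : T -> 'F_2) : (forall t, h (sub_opp t) = h t) ->
  (forall t, \sum_(e | fconnect sub_next t e) h e = 0)%R ->
  exists u : T -> 'F_2,
    forall t, u (sub_opp t) = (u t + h t)%R /\ u (sub_next t) = (u t + h t)%R.
Proof.
move=> ho hf; pose h' d := if insub d is Some t then h t else 0%R.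
have h'E t : h' (val t) = h t by rewrite /h' valK.
have [d dS|l lL|u uo uL] := disk_exact DB (h := h').
- by have := ho (SeqSub dS); rewrite -!h'E val_opp.
- case: l lL => [|d l] lL; first by rewrite big_nil.
  have lBL : d :: l \in B :: L by rewrite inE lL orbT.
  have dS : d \in S by apply: face_sub (mem_head d l).
  pose t : T := SeqSub dS; have [i iE] := orbit_sub_next t.
  rewrite -[RHS](hf t) (eq_bigl (mem (orbit sub_next t))) => [|e]; last first.
    exact: fconnect_orbit.
  rewrite -big_uniq ?orbit_uniq //=.
  transitivity (\sum_(e <- map val (orbit sub_next t)) h' e)%R; last first.
    by rewrite big_map; apply: eq_bigr => e _; rewrite h'E.
  rewrite iE (face_ofE lBL (mem_head d l)).
  by apply: perm_big; rewrite perm_sym perm_rot.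
exists (u \o val) => t /=; rewrite val_opp uo ?(valP t) // h'E; split=> //.
have [fBL tf] := face_of_mem (valP t).
by have := next_cycle (uL _ fBL) tf; rewrite val_next /flows h'E => /eqP.
Qed.

Hypothesis minimal : forall k, k < size L -> ~ area R k (map lab B).
Variable t0 : T.
Hypothesis t0B : val t0 \in B.

(** If the component of the outer face missed some face, then the empty label
    outside this component would show that the outer word has smaller area. *)
Lemma sub_connected t t' :
  connect [rel x y | (y == sub_opp x) || (y == sub_turn x)] t t'.
Proof.
set e := [rel x y | _].
have esym : connect_sym e.
  have fsym : connect_sym (relU (frel sub_opp) (frel sub_turn)).
    apply: relU_sym; apply: fconnect_sym; last exact: sub_turn_inj.
    exact: (can_inj sub_oppK).
  have ee : connect e =2 connect (relU (frel sub_opp) (frel sub_turn)).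
    by apply: eq_connect => x y /=; rewrite ![_ == y]eq_sym.
  by move=> x y; rewrite !ee.
suff all0 : forall x, connect e t0 x.
  by apply: connect_trans (all0 t'); rewrite esym.
have eopp x : connect e x (sub_opp x) by apply: connect1; rewrite /= eqxx.
have enext x : connect e x (sub_next x).
  apply: connect_trans (eopp x) (connect1 _).
  by rewrite /= /sub_turn sub_oppK eqxx orbT.
have ef : subrel (connect (frel sub_next)) (connect e).
  apply: connect_sub => x y /= /eqP <-.
  exact: enext.
have cf x y : val y \in face_of (val x) -> connect e t0 x = connect e t0 y.
  by rewrite -sub_fconnect => /ef/(same_connect_r esym)/(_ t0).
pose c0 d := if insub d is Some y then connect e t0 y else false.
have c0E y : c0 (val y) = connect e t0 y by rewrite /c0 valK.
have c0_face l d d' : l \in B :: L -> d \in l -> d' \in l -> c0 d = c0 d'.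
  move=> lBL dl d'l; have dS := face_sub lBL dl; have d'S := face_sub lBL d'l.
  have := cf (SeqSub dS) (SeqSub d'S); rewrite -!c0E /=; apply.
  by rewrite (face_ofE lBL).
pose m d := if c0 d then [:: lab d] else [::].
have readT l : {in l, forall d, c0 d} -> read m l = map lab l.
  by move=> lc; rewrite -read_lab; apply: eq_in_read => d /lc; rewrite /m => ->.
have c0B : {in B, forall d, c0 d}.
  by move=> d dB; rewrite (c0_face B d (val t0)) ?mem_head // c0E.
have ar : area R (count (has c0) L) (read m B).
  apply: (disk_area DB) => [d dS|l lL].
  - have := same_connect_r esym (eopp (SeqSub dS)) t0.
    rewrite /m -[d]/(val (SeqSub dS)) -val_opp !c0E /= => <-.
    by case: ifP => // _; rewrite val_opp (disk_lab DB dS).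
  - have lBL : l \in B :: L by rewrite inE lL orbT.
    case: (boolP (has c0 l)) => [/hasP[d dl cd]|/hasPn no].
      rewrite readT; first exact: (disk_face DB lL).
      by move=> d' d'l; rewrite -(c0_face l d).
    rewrite (_ : read m l = [::]); first exact: word_eq_refl.
    rewrite /read (_ : map m l = nseq (size l) [::]).
      by elim: (size l).
    elim: l {lL lBL} no => //= d l IHl no; rewrite IHl => [|d' d'l].
      by rewrite /m (negPf (no d (mem_head _ _))).
    by apply: no; rewrite inE d'l orbT.
rewrite readT // in ar.
have all_c : all (has c0) L.
  rewrite all_count eqn_leq count_size leqNgt; apply/negP => lt.
  exact: minimal lt ar.
move=> x; rewrite -c0E; have [fBL xf] := face_of_mem (valP x).
move: (fBL); rewrite inE => /orP[/eqP fB|fL]; first by apply: c0B; move: xf; rewrite fB.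
have /hasP[d df cd] := allP all_c _ fL.
by rewrite (c0_face _ _ d fBL).
Qed.

Lemma sub_euler :
  fcard sub_turn (T : finType) + fcard (sub_turn \o sub_opp) (T : finType) =
  fcard sub_opp (T : finType) + 2.
Proof.
have next_eq t : sub_turn (sub_opp t) = sub_next t by rewrite /sub_turn sub_oppK.
have := orbit_index (can_inj sub_oppK) => -[rE [sE [sEK rEP]]].
apply: (euler_of_exact sub_oppK sub_opp_neq sEK rEP sub_turn_inj t0 sub_connected).
move=> h ho hf; have [|t|u uP] := @sub_exact h; first exact: ho.
  rewrite -[RHS](hf t); apply: eq_bigl => x.
  by apply/esym/eq_fconnect => y; rewrite /= next_eq.
by exists u => t; rewrite next_eq.
Qed.

Definition disk_map : sphere_map :=
  SphereMap sub_oppK sub_opp_neq sub_turn_inj sub_connected sub_euler.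

Lemma disk_face_next : @face_next disk_map =1 sub_next.
Proof. by move=> t; rewrite /face_next /= /sub_turn sub_oppK. Qed.

Lemma disk_orbit t : orbit (@face_next disk_map) t = orbit sub_next t.
Proof.
rewrite /orbit (_ : order _ _ = order sub_next t).
  move: (order sub_next t) => n; elim: n t => // n IHn t.
  by rewrite !trajectS IHn disk_face_next.
by apply: eq_card => x; apply: eq_fconnect; apply: disk_face_next.
Qed.

Definition disk_removed (t : disk_map) : bool := val t \in B.

Lemma disk_removed_face (t : disk_map) : disk_removed (face_next t) = disk_removed t.
Proof.
rewrite disk_face_next /disk_removed (outer_face_of (valP (sub_next t))).
by rewrite (outer_face_of (valP (t : T))) face_of_next.
Qed.

Definition disk_lab_of (t : disk_map) : letter X := lab (val t).

Lemma disk_lab_opp (t : disk_map) :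
  disk_lab_of (Defs.opp t) = inv_letter (disk_lab_of t).
Proof. by rewrite /disk_lab_of val_opp (disk_lab DB (valP t)). Qed.

Lemma disk_label t : exists i,
  [seq disk_lab_of x | x <- orbit (@face_next disk_map) t] =
  rot i (map lab (face_of (val t))).
Proof.
have [i iE] := orbit_sub_next t; exists i.
by rewrite disk_orbit -map_rot -iE -map_comp.
Qed.

Lemma disk_kept_face (t : disk_map) : ~~ disk_removed t -> face_of (val t) \in L.
Proof.
have [fBL _] := face_of_mem (valP t).
rewrite /disk_removed outer_face_of; last exact: (valP t).
by move=> fB; move: fBL; rewrite inE (negPf fB).
Qed.

Lemma disk_lab_face (t : disk_map) : ~~ disk_removed t ->
  Rstar R [seq disk_lab_of x | x <- orbit (@face_next disk_map) t].
Proof.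
move=> /disk_kept_face fL; have [i ->] := disk_label t.
by apply/Rstar_rot/(disk_face DB).
Qed.

Definition disk_diagram : diagram R :=
  Diagram disk_removed_face disk_lab_opp disk_lab_face.

Lemma disk_outer_face (t : disk_diagram) :
  removed t = fconnect (@face_next disk_diagram) t0 t.
Proof.
rewrite fconnect_orbit disk_orbit -fconnect_orbit sub_fconnect.
by rewrite (face_ofE (mem_head _ _) t0B).
Qed.

Lemma disk_order : order (@face_next disk_diagram) t0 = size B.
Proof.
rewrite -size_orbit disk_orbit; have [i iE] := orbit_sub_next t0.
by rewrite -(size_map val) iE size_rot (face_ofE (mem_head _ _) t0B).
Qed.

(** A boundary vertex of degree 1 would make two consecutive letters of the outer
    word inverse to each other. *)
Lemma disk_no_spike (t : disk_diagram) : cyclically_reduced (map lab B) ->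
  removed t -> turn t != t.
Proof.
move=> Bred rt; apply/eqP => tt.
have nt : sub_next (sub_opp t) = t by [].
pose z := sub_opp t.
have zB : val z \in B.
  have := disk_removed_face z; rewrite disk_face_next /z nt.
  by rewrite /disk_removed => <-.
have [i iE] := orbit_sub_next z; rewrite (face_ofE (mem_head _ _) zB) in iE.
have [] := orbit_next_rot z sub_next_inj; rewrite nt.
case: (behead _) => [|y s] oz ot.
  have : t \in orbit sub_next z by rewrite -fconnect_orbit -nt fconnect1.
  by rewrite oz inE => /eqP tz; have := sub_opp_neq t; rewrite -/z -tz eqxx.
have yt : y = t.
  by have [+ _] := orbit_next_rot t sub_next_inj; rewrite ot /= => -[].
have := Bred _ (ex_intro _ i erefl); rewrite -map_rot -iE oz yt.
move=> /(_ [::] (map lab (map val s)) (lab (val z))); apply.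
by rewrite /= -(disk_lab DB (valP z)) -val_opp /z sub_oppK.
Qed.

(** If two faces are mirror images of each other across an edge, that edge can
    be relabelled by the inverse of the remaining part of both boundaries: this
    makes both faces trivial without changing any other label, so that the
    outer word has smaller area. *)
Lemma disk_reduced : reduced disk_diagram.
Proof.
case=> t [rt rot ndd labE]; apply: contrapT => _.
pose z := sub_opp t.
have tL := disk_kept_face rt; have zL := disk_kept_face rot.
pose rest := map disk_lab_of (behead (orbit sub_next t)).
have [ot _] := orbit_next_rot t sub_next_inj.
have [oz onz] := orbit_next_rot z sub_next_inj.
have zrest : map disk_lab_of (behead (orbit sub_next z)) = inv_word rest.
  move: labE; rewrite /face_label !disk_orbit disk_face_next -/z onz ot map_rcons.
  move/(congr1 (@inv_word X)); rewrite inv_wordK /= inv_word_cons cats1.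
  by case/rcons_inj.
pose D := val t; pose D' := val z.
have oD : opp D = D' by rewrite /D' val_opp.
have oD' : opp D' = D by rewrite -val_opp /z sub_oppK.
pose m d := if d == D then inv_word rest else if d == D' then rest else [:: lab d].
have D'D : (D' == D) = false.
  by rewrite (inj_eq val_inj); apply/negbTE/sub_opp_neq.
have mD : m D = inv_word rest by rewrite /m eqxx.
have mD' : m D' = rest by rewrite /m D'D eqxx.
have mE d : d != D -> d != D' -> m d = [:: lab d] by rewrite /m => /negPf-> /negPf->.
have tz : z \notin orbit sub_next t.
  by rewrite -fconnect_orbit; move: ndd; rewrite fconnect_orbit disk_orbit -fconnect_orbit.
have zt : t \notin orbit sub_next z.
  by rewrite -fconnect_orbit fconnect_sym ?fconnect_orbit //; apply: sub_next_inj.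
have read_other s : t \notin s -> z \notin s ->
    read m (map val s) = map disk_lab_of s.
  move=> ts zs; rewrite /disk_lab_of (map_comp lab val) -read_lab.
  apply: eq_in_read => d /mapP[x xs ->]; apply: mE.
    by rewrite (inj_eq val_inj); apply: contraNneq ts => <-.
  by rewrite (inj_eq val_inj); apply: contraNneq zs => <-.
have read_orbit x : free_eq (read m (map val (orbit sub_next x))) [::] ->
    free_eq (read m (face_of (val x))) [::].
  have [i ->] := orbit_sub_next x; rewrite /rot read_cat => /free_eq_rot.
  by rewrite -read_cat cat_take_drop.
have triv_t : free_eq (read m (face_of D)) [::].
  apply: read_orbit; rewrite ot [map _ _]/= -cat1s read_cat.
  have := orbit_uniq sub_next t; move: tz; rewrite ot inE negb_or /=.
  move=> /andP[_ zb] /andP[tb _]; rewrite read_other // -/rest.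
  rewrite /read /= cats0 -/D mD.
  have := word_eq_cancel_word (fun _ => False) [::] (inv_word rest) [::].
  by rewrite inv_wordK !cats0.
have triv_z : free_eq (read m (face_of D')) [::].
  apply: read_orbit; rewrite oz [map _ _]/= -cat1s read_cat.
  have := orbit_uniq sub_next z; move: zt; rewrite oz inE negb_or /=.
  move=> /andP[_ tb] /andP[zb _]; rewrite read_other // zrest.
  rewrite /read /= cats0 -/D' mD'.
  by have := word_eq_cancel_word (fun _ => False) [::] rest [::]; rewrite !cats0.
have DS : D \in S by apply: valP.
have D'S : D' \in S by apply: valP.
have off l : l \in B :: L -> l != face_of D -> l != face_of D' -> read m l = map lab l.
  move=> lBL lD lD'; rewrite -read_lab; apply: eq_in_read => d dl; apply: mE.
    by apply: contraNneq lD => <-; rewrite (face_ofE lBL).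
  by apply: contraNneq lD' => <-; rewrite (face_ofE lBL).
pose c l := (l != face_of D) && (l != face_of D').
have small : count c L < size L.
  rewrite ltn_neqAle count_size andbT -all_count; apply/allPn; exists (face_of D) => //.
  by rewrite /c eqxx.
apply: (minimal small); rewrite -(off B) ?mem_head //; last 2 first.
- by apply: contra rt; rewrite /= /disk_removed outer_face_of // eq_sym.
- by apply: contra rot; rewrite /= /disk_removed outer_face_of // eq_sym.
apply: (disk_area DB) => [d dS|l lL].
  have [_ ood _] := disk_opp DB dS.
  case: (eqVneq d D) => [->|dD]; first by rewrite oD mD mD' inv_wordK.
  case: (eqVneq d D') => [->|dD']; first by rewrite oD' mD mD'.
  rewrite !mE ?(disk_lab DB dS) //.
    by apply: contraNneq dD' => oE; rewrite -ood oE oD.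
  by apply: contraNneq dD => oE; rewrite -ood oE oD'.
case: ifPn => [/andP[lD lD']|].
  by rewrite off ?inE ?lL ?orbT //; apply: (disk_face DB).
by rewrite negb_and !negbK => /orP[]/eqP->.
Qed.

End Realise.

(** * The theorem *)

Lemma Rstar_reduced X (R : word X -> Prop) r :
  (forall q, R q -> cyclically_reduced q) -> Rstar R r -> freely_reduced r.
Proof.
move=> Rred [q Rq] [[k ->]|[k ->]]; first by apply: (Rred q Rq); exists k.
have [j jE] := inv_word_rot k (inv_word q); rewrite inv_wordK in jE.
rewrite -[rot k _]inv_wordK jE; apply: inv_freely_reduced.
by apply: (Rred q Rq); exists j.
Qed.

(** Among the nontrivial words shorter than all relators, one of minimal area
    and, for that area, of minimal length bounds a diagram that contradicts the
    bound given by curvature. *)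
Lemma short_word_trivial X (R : word X -> Prop) n : 2 <= n ->
  (forall r, R r -> cyclically_reduced r) -> tau' R ->
  small_cancellation R (1 / 2)%R -> (forall r, R r -> n <= size r) ->
  forall w, size w < n -> word_eq R w [::] -> free_eq w [::].
Proof.
move=> n2 Rred tau half Rn w wn w1.
have [_ [|k]] := word_eq_area w1; first by exists 0; apply: area_nil.
elim/ltn_ind: k w wn {w1} => k IHk w.
have [s] := ubnP (size w); elim: s w => // s IHs w ws wn wk.
apply: contrapT => w1.
have wred : cyclically_reduced w.
  move=> _ [i ->] u v a wE; apply: w1.
  have w'k : area R k (u ++ v).
    apply: (@area_fold _ _ _ _ _ a); rewrite -wE /rot.
    by apply: area_rot; rewrite cat_take_drop.
  have sz : size (u ++ v) < size w.
    by rewrite -(size_rot i w) wE !size_cat /=; lia.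
  have uv1 : free_eq (u ++ v) [::].
    by apply: IHs w'k; [apply: leq_trans sz _ | apply: ltn_trans sz wn].
  rewrite -(cat_take_drop i w); apply: free_eq_rot; rewrite -/(rot i w) wE.
  exact: word_eq_trans (word_eq_cancel _ _ _ _) uv1.
case: w => [|x0 w] in ws wn wk w1 wred *; first by apply: w1; apply: word_eq_refl.
have [B [L [opp [lab [DB Bw Lk]]]]] := area_disk x0 wk.
have min m : m < size L -> ~ area R m (map lab B).
  by rewrite Lk Bw => mk wm; apply: w1; apply: IHk mk _ wn wm.
have [d0 B0] : exists d0, d0 \in B.
  by case: (B) Bw => // d0 B' _; exists d0; apply: mem_head.
have d0S : d0 \in B ++ flatten L by rewrite mem_cat B0.
pose t0 : seq_sub (B ++ flatten L) := SeqSub d0S.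
pose M : diagram R := @disk_diagram _ _ _ _ _ _ DB min t0 B0.
have M_red : reduced M by apply: disk_reduced.
have : n <= order (@face_next M) t0.
  apply: (@boundary_length _ _ M t0) => //.
  - by move=> r; apply: Rstar_reduced.
  - move=> t rt; have [r Rr rE] := Rstar_size (lab_face rt).
    by rewrite /relator_length /face_label -rE; apply: Rn.
  - by move=> t; apply: tau.
  - by move=> t; apply: disk_no_spike; rewrite Bw.
  - by move=> t; apply: disk_outer_face.
by rewrite disk_order -(size_map lab) Bw leqNgt wn.
Qed.

(** Diagrams over fewer relators are diagrams over all of them. *)
Lemma tau'_sub X (R R' : word X -> Prop) :
  (forall r, R' r -> R r) -> tau' R -> tau' R'.
Proof.
move=> R'R tau [M rem rem_face lb lb_opp lb_face] Mred.
have sub r : Rstar R' r -> Rstar R r by case=> q /R'R; exists q.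
pose M' : diagram R := Diagram rem_face lb_opp (fun d rd => sub _ (lb_face d rd)).
exact: (tau M' Mred).
Qed.

Lemma small_cancellation_sub X (R R' : word X -> Prop) lambda :
  (forall r, R' r -> R r) -> small_cancellation R lambda ->
  small_cancellation R' lambda.
Proof.
move=> R'R half s rho [r1 [r2 [r1R r2R r12 s1 s2]]] rhoR sr.
have sub r : Rstar R' r -> Rstar R r by case=> q /R'R; exists q.
by apply: half (sub _ rhoR) sr; exists r1, r2; split=> //; apply: sub.
Qed.

Theorem proposition4p5 (X : Type) (P : presentation X)
    (G : groupType) (g : X -> G) (hG : presents P g)
    (htau : tau' P) (hC : small_cancellation P (1 / 2)%R) :
  (forall r_min : nat, shortest_relator_length P r_min ->
     forall W : word X, ~ free_eq W [::] -> eval g W = 1%g ->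
       r_min <= size W) /\
  ((exists2 r, P r & 2 <= size r) -> exists x : G, x <> 1%g).
Proof.
case: hG => _ evalP.
have eval1 w : eval g w = 1%g -> word_eq P w [::] by move=> w1; apply/evalP.
split=> [r_min [_ r_le] w w_nt w1 | [r Pr r2]].
  rewrite leqNgt; apply/negP => lt; apply: w_nt.
  case: (leqP 2 r_min) => [r2|r1].
    apply: (short_word_trivial r2 _ htau hC r_le lt (eval1 _ w1)).
    exact: relator_reduced.
  have /size0nil -> : size w = 0 by lia.
  exact: word_eq_refl.
apply: contrapT => triv.
have G1 (x : G) : x = 1%g by apply: contrapT => x1; apply: triv; exists x.
case: r Pr r2 => // a r Pr r2.
(* The shortest relator may have length 1.  By C'(1/2), a letter that is a
   relator by itself occurs in no longer relator, so that erasing all such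
   letters leaves a presentation by the relators of length at least 2; there
   the first part shows that a letter of such a relator is not trivial. *)
pose R' r := P r /\ 2 <= size r.
pose dead (b : letter X) := `[< exists c, P [:: c] /\ (c = b \/ c = inv_letter b) >].
have dead_inv b : dead (inv_letter b) = dead b.
  apply/asbool_equiv_eq; split=> -[c [Pc cb]]; exists c; split=> //.
    by rewrite inv_letterK in cb; case: cb; [right | left].
  by rewrite inv_letterK; case: cb; [right | left].
have dead_star b : dead b -> Rstar P [:: b].
  move=> /asboolP[c [Pc cb]]; exists [:: c] => //.
  case: cb => ->; [left | right]; exists 0; rewrite rot0 //.
  by rewrite /inv_word /= inv_letterK.
have alive q : P q -> 2 <= size q -> all (predC dead) q.
  move=> Pq q2.
  have cut u b v : q = u ++ b :: v -> ~~ dead b.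
    move=> qE; apply/negP => /dead_star bR.
    have qR : Rstar P (b :: v ++ u).
      by exists q => //; left; exists (size u); rewrite qE rot_size_cat.
    have pc : piece P [:: b].
      exists [:: b], (b :: v ++ u); split=> //; last 2 first.
      - by exists [::].
      - by exists (v ++ u).
      by case=> /(congr1 size); move: q2; rewrite qE !size_cat /=; lia.
    have := hC _ _ pc bR; rewrite /prefix_of => /(_ (ex_intro _ [::] erefl)) /=.
    lra.
  suff tail s u : q = u ++ s -> all (predC dead) s by apply: (tail q [::]).
  elim: s u => //= b s IHs u qE; rewrite (cut u b s) //=.
  by apply: (IHs (rcons u b)); rewrite cat_rcons.
have erase u v : word_eq P u v ->
    word_eq R' (filter (predC dead) u) (filter (predC dead) v).
  elim=> [?|? ? _|? ? ? _ + _|u' v' b|u' v' q Pq].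
  - exact: word_eq_refl.
  - exact: word_eq_sym.
  - exact: word_eq_trans.
  - rewrite !filter_cat /= dead_inv; case: (dead b) => /=; first exact: word_eq_refl.
    exact: word_eq_cancel.
  rewrite !filter_cat; case: (leqP 2 (size q)) => q2.
    rewrite (all_filterP (alive q Pq q2)); exact: word_eq_relator.
  have -> : [seq x <- q | predC dead x] = [::].
    case: q Pq q2 => [|b [|//]] Pb _ //=; rewrite (_ : dead b) //.
    by apply/asboolP; exists b; split=> //; left.
  exact: word_eq_refl.
have := erase _ _ (eval1 [:: a] (G1 _)); rewrite /=.
have /= /andP[-> _] := alive _ Pr r2.
move/(short_word_trivial (leqnn 2)) => a1.
apply: (@free_eq_letter _ a); apply: a1 => //.
- by move=> q [Pq _]; apply: (relator_reduced Pq).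
- by apply: tau'_sub htau => q [].
- by apply: small_cancellation_sub hC => q [].
by move=> q [].
Qed.
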